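(* Let $\lambda_1,\dots,\lambda_6\in\mathbb{C}$ be parameters and let $u_1,\dots,u_6,w_1,\dots,w_6$ be canonical variables with $[u_i,w_j]=2\hbar\delta_{ij}$, $[u_i,u_j]=[w_i,w_j]=0$, and $q=e^{\hbar}$. For distinct $i,j,k$ put $$P_{ijk}=e^{\frac{1}{2\hbar}(u_i-w_i)(w_j-w_k)}\,\rho_{jk}\,e^{\frac{\lambda_j-\lambda_k}{2\hbar}(u_k-w_i)},$$ where $\rho_{jk}$ is the transposition exchanging the indices $j$ and $k$ of the canonical variables (and not of the parameters $\lambda$), and $$R(\lambda_i,\lambda_j,\lambda_k)_{ijk}=\Psi_q(e^{u_k-w_i})^{-1}\,\Psi_q(e^{u_k-w_i-w_j+w_k+\lambda_k})^{-1}\,\Psi_q(e^{u_i-u_j+\lambda_i})\,\Psi_q(e^{u_i-u_j+w_j-w_k+\lambda_i-\lambda_k})\,P_{ijk},$$ or equivalently $$R(\lambda_i,\lambda_j,\lambda_k)_{ijk}=\Psi_q(e^{w_k-w_j+\lambda_k})^{-1}\,\Psi_q(e^{u_k-w_i})^{-1}\,P_{ijk}\,\Psi_q(e^{w_i-u_k+\lambda_i-\lambda_k})\,\Psi_q(e^{w_j-w_k+\lambda_j}).$$ Then $R$ satisfies the tetrahedron equation $$R(\lambda_4,\lambda_5,\lambda_6)_{456}\,R(\lambda_2,\lambda_3,\lambda_6)_{236}\,R(\lambda_1,\lambda_3,\lambda_5)_{135}\,R(\lambda_1,\lambda_2,\lambda_4)_{124}$$ $$=R(\lambda_1,\lamb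da_2,\lambda_4)_{124}\,R(\lambda_1,\lambda_3,\lambda_5)_{135}\,R(\lambda_2,\lambda_3,\lambda_6)_{236}\,R(\lambda_4,\lambda_5,\lambda_6)_{456}.$$
   Context: The parameter $q=e^{\hbar}$ is generic. The quantum dilogarithm is $\Psi_q(Y)=1/(-qY;q^2)_\infty$ with $(z;q)_\infty=\prod_{n\ge0}(1-zq^n)$; it is used through its expansions $\Psi_q(Y)=\sum_{n\ge0}\frac{(-qY)^n}{(q^2;q^2)_n}$ and $\Psi_q(Y)^{-1}=\sum_{n\ge0}\frac{q^{n^2}Y^n}{(q^2;q^2)_n}$. The exponentials $e^{\pm u_i},e^{\pm w_i}$ generate a direct product of $q$-Weyl algebras: $e^{u_i}e^{w_j}=q^{2\delta_{ij}}e^{w_j}e^{u_i}$, all other pairs commuting. $N_n$ is the group generated by $e^{\pm\frac{1}{2\hbar}u_iw_j}$ $(i\ne j)$, $e^{\pm\frac1{2\hbar}u_iu_j}$, $e^{\pm\frac1{2\hbar}w_iw_j}$ $(i<j)$, $e^{\frac a\hbar u_i}$, $e^{\frac a\hbar w_i}$ $(a\in\mathbb{C})$ and $b\in\mathbb{C}^\times$, with $i,j\in\{1,\dots,n\}$, the multiplication being given by the (generalized) Baker-Campbell-Hausdorff formula and the canonical commutation relations; exponentials of combinations such as $\frac1{2\hbar}(u_i-w_i)(w_j-w_k)$ are regarded as elements of it. The symmetric group $\mathfrak{S}_n$, generated by the transpositions $\rho_{ij}$, acts on $N_n$ by conjugation, permuting the indices of the canonical variables, and $P_{ijk}\in N_6\rtimes\mathfrak{S}_6$.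 The group $N_6\rtimes\mathfrak{S}_6$ acts on the $q$-Weyl algebra by the adjoint action $\mathrm{Ad}(P)(x)=PxP^{-1}$; $\mathrm{Ad}(P_{ijk})$ is induced by an affine-linear transformation of the canonical variables. Meaning of the equation: on each side all factors $P_{ijk}$ are moved to the right using $P\,\Psi_q(x)=\Psi_q(PxP^{-1})\,P$, so that each side becomes a product of 16 factors $\Psi_q(\cdot)^{\pm1}$ times an element of $N_6\rtimes\mathfrak{S}_6$; the product of quantum dilogarithms is expanded as a formal Laurent series in the $q$-Weyl algebra generators $e^{u_i},e^{w_i}$. *)

(* Defs.v *)
From HB Require Import structures.
From mathcomp Require Import all_boot all_order all_algebra all_fingroup.
From mathcomp Require Import complex ring.
From mathcomp Require Import boolp classical_sets cardinality fsbigop.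
From mathcomp Require Import reals trigo sequences exp.

Set Implicit Arguments.
Unset Strict Implicit.
Unset Printing Implicit Defensive.

Import Order.TTheory GRing.Theory Num.Theory.
Local Open Scope classical_set_scope.
Local Open Scope complex_scope.
Local Open Scope ring_scope.

(* An exponential function of a field. Everything below is defined over a      *)
(* field with such a function and is used for R[i] and the complex             *)
(* exponential cexp.                                                           *)
Record expmap (K : fieldType) := Expmap {
  expmap_fun :> K -> K;
  expmap0 : expmap_fun 0 = 1;
  expmapD : {morph expmap_fun : x y / x + y >-> x * y} }.

Lemma expmap_neq0 (K : fieldType) (e : expmap K) x : e x != 0.
Proof.
apply/eqP => x0; have := expmapD e x (- x).
by rewrite subrr expmap0 x0 mul0r => /eqP; rewrite oner_eq0.
Qed.

Section ComplexExponential.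
Variable R : realType.

Definition cexp_fun (z : R[i]) : R[i] :=
  let: a +i* b := z in (expR a * cos b) +i* (expR a * sin b).

Lemma cexp_fun0 : cexp_fun 0 = 1.
Proof. by rewrite /cexp_fun /= expR0 cos0 sin0 mulr0 mulr1. Qed.

Lemma cexp_funD : {morph cexp_fun : x y / x + y >-> x * y}.
Proof.
move=> [a b] [c d]; rewrite /cexp_fun /= expRD cosD sinD.
apply/eqP; rewrite eq_complex /=; apply/andP; split; apply/eqP.
  by rewrite mulrBr; congr (_ - _); rewrite mulrACA.
by rewrite mulrDr addrC; congr (_ + _); rewrite mulrACA.
Qed.

Definition cexp : expmap R[i] := Expmap cexp_fun0 cexp_funD.

End ComplexExponential.

Definition not_root_of_unity (K : pzRingType) (q : K) :=
  forall m : nat, (0 < m)%N -> q ^+ m != 1.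

(* A linear form in u_1, ..., u_n, w_1, ..., w_n is the column of its          *)
(* coefficients, those of the u_i first; [x, y] = 2 hbar (omega x y).          *)
Section LinearForms.
Variable n : nat.

Definition omega_mx (K : pzRingType) : 'M[K]_(n + n) :=
  block_mx 0 1%:M (- 1%:M) 0.

Definition omega (K : pzRingType) (x y : 'cV[K]_(n + n)) : K :=
  (x^T *m omega_mx K *m y) 0 0.

Definition u_ (i : 'I_n) : 'cV[int]_(n + n) := delta_mx (lshift n i) 0.
Definition w_ (i : 'I_n) : 'cV[int]_(n + n) := delta_mx (rshift n i) 0.

Definition symplectic (M : 'M[int]_(n + n)) :=
  M^T *m omega_mx int *m M == omega_mx int.

(* u_i |-> u_(s i), w_i |-> w_(s i) *)
Definition idx_mx (s : 'S_n) : 'M[int]_(n + n) :=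
  block_mx (perm_mx s^-1%g) 0 0 (perm_mx s^-1%g).

Lemma perm_mxV_delta (s : 'S_n) i :
  perm_mx s^-1%g *m delta_mx i 0 = delta_mx (s i) 0 :> 'cV[int]_n.
Proof.
apply/colP => k; rewrite -row_permE !mxE /= !andbT; congr (_%:R).
by rewrite (can2_eq (permKV s) (permK s)).
Qed.

Lemma idx_mx_u s i : idx_mx s *m u_ i = u_ (s i).
Proof.
rewrite /idx_mx /u_ !delta_mx_ushift mul_block_col !mulmx0 mul0mx !addr0.
by rewrite perm_mxV_delta.
Qed.

Lemma idx_mx_w s i : idx_mx s *m w_ i = w_ (s i).
Proof.
rewrite /idx_mx /w_ !delta_mx_dshift mul_block_col !mulmx0 mul0mx !add0r.
by rewrite perm_mxV_delta.
Qed.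

Lemma omegaE (K : pzRingType) (x y : 'cV[K]_(n + n)) :
  omega x y = \sum_i (x (lshift n i) 0 * y (rshift n i) 0
                      - x (rshift n i) 0 * y (lshift n i) 0).
Proof.
rewrite /omega -[in LHS](vsubmxK x) -[in LHS](vsubmxK y) tr_col_mx /omega_mx.
rewrite mul_row_block mul_row_col !mulmx0 mulmxN !mulmx1 add0r addr0.
rewrite addrC mulNmx !mxE sumrB; congr (_ - _); apply: eq_bigr => i _;
  by rewrite !mxE.
Qed.

Lemma omega_mxK (K : pzRingType) : omega_mx K *m omega_mx K = - 1%:M.
Proof.
rewrite /omega_mx mulmx_block !mul0mx !mulmx0 ?mulmxN ?mulNmx ?mulmx1 ?mul1mx.
by rewrite !add0r !addr0 (scalar_mx_block n n) opp_block_mx oppr0.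
Qed.

Lemma omegaDl (K : pzRingType) (x y z : 'cV[K]_(n + n)) :
  omega (x + y) z = omega x z + omega y z.
Proof. by rewrite /omega linearD !mulmxDl mxE. Qed.

Lemma omegaDr (K : pzRingType) (x y z : 'cV[K]_(n + n)) :
  omega x (y + z) = omega x y + omega x z.
Proof. by rewrite /omega mulmxDr mxE. Qed.

Lemma omegaNr (K : pzRingType) (x y : 'cV[K]_(n + n)) :
  omega x (- y) = - omega x y.
Proof. by rewrite /omega mulmxN mxE. Qed.

Lemma omega0l (K : pzRingType) (y : 'cV[K]_(n + n)) : omega 0 y = 0.
Proof. by rewrite /omega trmx0 !mul0mx mxE. Qed.

Lemma omega0r (K : pzRingType) (y : 'cV[K]_(n + n)) : omega y 0 = 0.
Proof. by rewrite /omega !mulmx0 mxE. Qed.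

Lemma omegaC (K : comPzRingType) (x y : 'cV[K]_(n + n)) :
  omega y x = - omega x y.
Proof.
rewrite !omegaE -sumrN; apply: eq_bigr => i _.
by rewrite opprB [X in X - _]mulrC [X in _ - X]mulrC.
Qed.

Lemma omegaZl (K : comPzRingType) c (x y : 'cV[K]_(n + n)) :
  omega (c *: x) y = c * omega x y.
Proof. by rewrite /omega linearZ /= -!scalemxAl mxE. Qed.

Lemma omegaZr (K : comPzRingType) c (x y : 'cV[K]_(n + n)) :
  omega x (c *: y) = c * omega x y.
Proof. by rewrite /omega -!scalemxAr mxE. Qed.

Lemma symplectic1 : symplectic 1%:M.
Proof. by rewrite /symplectic trmx1 mul1mx mulmx1. Qed.

Lemma symplecticM M M' : symplectic M -> symplectic M' -> symplectic (M *m M').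
Proof.
move=> /eqP sM /eqP sM'; rewrite /symplectic trmx_mul !mulmxA.
by rewrite -(mulmxA _ M^T) -(mulmxA _ _ M) sM sM'.
Qed.

Definition spinv (M : 'M[int]_(n + n)) := - (omega_mx int *m M^T *m omega_mx int).

Lemma spinvK M : symplectic M -> spinv M *m M = 1%:M.
Proof.
move=> /eqP sM; rewrite /spinv mulNmx -!mulmxA (mulmxA M^T) sM omega_mxK.
by rewrite opprK.
Qed.

Lemma spinvKr M : symplectic M -> M *m spinv M = 1%:M.
Proof. by move=> sM; apply: mulmx1C; exact: spinvK. Qed.

Lemma symplecticV M : symplectic M -> symplectic (spinv M).
Proof.
move=> sM; rewrite /symplectic -{1}(eqP sM) !mulmxA -trmx_mul spinvKr //.
by rewrite trmx1 mul1mx -mulmxA spinvKr // mulmx1.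
Qed.

Lemma symplectic_idx s : symplectic (idx_mx s).
Proof.
rewrite /symplectic /idx_mx /omega_mx tr_block_mx !trmx0 !mulmx_block.
rewrite !mul0mx !mulmx0 !add0r !addr0 mulmx1 mulmxN mulmx1 mulNmx tr_perm_mx.
by rewrite !mul0mx -perm_mxM mulVg perm_mx1.
Qed.

Lemma idx_mxM s t : idx_mx (t * s) = idx_mx s *m idx_mx t.
Proof.
rewrite /idx_mx mulmx_block !mul0mx !mulmx0 !add0r !addr0 -perm_mxM.
by rewrite invMg.
Qed.

Lemma idx_mx1 : idx_mx 1 = 1%:M.
Proof. by rewrite /idx_mx invg1 perm_mx1 -scalar_mx_block. Qed.

Lemma omegaaa (K : comPzRingType) (x : 'cV[K]_(n + n)) : omega x x = 0.
Proof. by rewrite omegaE big1 // => i _; rewrite mulrC subrr. Qed.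

Lemma symplecticP (M : 'M[int]_(n + n)) :
  (forall x y, omega (M *m x) (M *m y) = omega x y) -> symplectic M.
Proof.
move=> oM; apply/eqP/matrixP => i j.
have E (A : 'M[int]_(n + n)) k l :
    A k l = ((delta_mx k 0 : 'cV_(n + n))^T *m A *m
      (delta_mx l 0 : 'cV_(n + n))) 0 0.
  by rewrite -mulmxA -colE trmx_delta -rowE !mxE.
rewrite E [RHS]E; have := oM (delta_mx i 0) (delta_mx j 0).
by rewrite /omega trmx_mul !mulmxA.
Qed.

(* The derivation [f g / (2 hbar), x] = (omega f x) g + (omega g x) f of the    *)
(* linear forms x has square zero if [f, g] = 0, so that its exponential is    *)
(* then 1 + itself.                                                            *)
Definition expQ_mx (f g : 'cV[int]_(n + n)) : 'M[int]_(n + n) :=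
  1%:M + (g *m f^T + f *m g^T) *m omega_mx int.

Lemma expQ_mxE f g x : expQ_mx f g *m x = x + omega f x *: g + omega g x *: f.
Proof.
have E (a b c : 'cV[int]_(n + n)) : a *m b^T *m omega_mx int *m c = omega b c *: a.
  rewrite -!mulmxA [X in a *m X]mx11_scalar mul_mx_scalar /omega -!mulmxA.
  by [].
by rewrite /expQ_mx mulmxDl mul1mx !mulmxDl !E addrA.
Qed.

Lemma symplectic_expQ f g : omega f g = 0 -> symplectic (expQ_mx f g).
Proof.
move=> fg; apply: symplecticP => x y; rewrite !expQ_mxE.
have gf : omega g f = 0 by rewrite omegaC fg oppr0.
rewrite !(omegaDl, omegaDr, omegaZl, omegaZr) !omegaaa fg gf !mulr0 !addr0 ?add0r.
rewrite [omega x g]omegaC [omega x f]omegaC.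
by ring.
Qed.

Lemma expQ_mxD f g h : omega f g = 0 -> omega f h = 0 -> omega g h = 0 ->
  expQ_mx f (g + h) = expQ_mx f g *m expQ_mx f h.
Proof.
move=> fg fh gh.
have E (a b c d : 'cV[int]_(n + n)) :
    (a *m b^T *m omega_mx int) *m (c *m d^T *m omega_mx int) =
    omega b c *: (a *m d^T *m omega_mx int).
  rewrite -!mulmxA (mulmxA b^T) (mulmxA _ c) [X in a *m (X *m _)]mx11_scalar.
  by rewrite mul_scalar_mx -scalemxAr.
have hf : omega h f = 0 by rewrite omegaC fh oppr0.
have gf : omega g f = 0 by rewrite omegaC fg oppr0.
rewrite /expQ_mx; set A := (g *m _ + _) *m _; set B := (h *m _ + _) *m _.
have AB : A *m B = 0.
  by rewrite /A /B !mulmxDl !mulmxDr !E fh omegaaa gf gh !scale0r !addr0.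
rewrite [RHS]mulmxDl mul1mx mulmxDr mulmx1 AB addr0 -addrA [B + A]addrC.
congr (_ + _); rewrite /A /B -mulmxDl; congr (_ *m _).
by rewrite linearD /= mulmxDl mulmxDr addrACA.
Qed.

Lemma omega_symplectic_int M (x y : 'cV[int]_(n + n)) :
  symplectic M -> omega (M *m x) (M *m y) = omega x y.
Proof. by move=> /eqP sM; rewrite /omega -[in RHS]sM trmx_mul !mulmxA. Qed.

Lemma mulmx_colP (A B : 'M[int]_(n + n)) :
  (forall x : 'cV_(n + n), A *m x = B *m x) -> A == B.
Proof.
move=> AB; apply/eqP/matrixP => i j.
by have /colP/(_ i) := AB (delta_mx j 0); rewrite -!colE !mxE.
Qed.

End LinearForms.

Section ScalarExtension.
Variables (K : fieldType) (n : nat).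

Definition toC p q (A : 'M[int]_(p, q)) : 'M[K]_(p, q) := map_mx intr A.

Lemma toCM p q r (A : 'M_(p, q)) (B : 'M_(q, r)) :
  toC (A *m B) = toC A *m toC B.
Proof. exact: map_mxM. Qed.

Lemma toC1 p : toC (1%:M : 'M_p) = 1%:M.
Proof. by rewrite /toC map_scalar_mx. Qed.

Lemma omega_toC (x y : 'cV[int]_(n + n)) :
  omega (toC x) (toC y) = (omega x y)%:~R.
Proof.
rewrite !omegaE (big_morph (fun z : int => z%:~R) (intrD _) (mulr0z _)).
apply: eq_bigr => i _.
by rewrite !mxE intrB !intrM.
Qed.

Lemma toC_omega_mx : toC (omega_mx n int) = omega_mx n _.
Proof. by rewrite /toC /omega_mx map_block_mx map_mxN !map_mx0 !map_mx1. Qed.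

Lemma omega_symplectic M (x y : 'cV[K]_(n + n)) :
  symplectic M -> omega (toC M *m x) (toC M *m y) = omega x y.
Proof.
move=> /eqP sM; rewrite /omega -toC_omega_mx -[in RHS]sM !toCM trmx_mul.
by rewrite /toC map_trmx !mulmxA.
Qed.

End ScalarExtension.
Arguments toC {K p q} A.

(* The group Sp_2n(Z) |>< Heis_n(K), whose Lie algebra consists of the         *)
(* polynomials of degree at most 2 in the canonical variables. The triple      *)
(* (b, a, M) stands for b e^(a / hbar) M, where the factor M, a product of     *)
(* exponentials of quadratic forms, acts by conjugation on the canonical       *)
(* variables as the matrix M. By the Baker-Campbell-Hausdorff formula          *)
(*   e^(a / hbar) e^(a' / hbar) = e^(omega a a' / hbar) e^((a + a') / hbar),   *)
(*   M e^(a / hbar) = e^(M a / hbar) M.                                        *)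
(* This is the ambient group of N_n: it contains the nonzero scalars (scal),   *)
(* the exponentials e^(a / hbar) of linear forms (expL) and the exponentials   *)
(* e^(f g / (2 hbar)) for commuting integral linear forms f and g (expQ), such *)
(* as u_i w_j, u_i u_j, w_i w_j for i != j and (u_i - w_i) (w_j - w_k). The    *)
(* carrier does not depend on e and hbar, but the group law does.              *)
Section Jacobi.
Variables (K : fieldType) (n : nat).
Local Notation triple := (K * 'cV[K]_(n + n) * 'M[int]_(n + n))%type.

Definition jacobi_pred (x : triple) := (x.1.1 != 0) && symplectic x.2.

Definition jacobi (e : expmap K) (hbar : K) := {x : triple | jacobi_pred x}.

Variables (e : expmap K) (hbar : K).
Local Notation J := (jacobi e hbar).

HB.instance Definition _ := Choice.on J.

Definition mkjacobi (x : triple) (px : jacobi_pred x) : J :=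
  exist jacobi_pred x px.

Lemma jacobi_one_subproof : jacobi_pred (1, 0, 1%:M).
Proof. by rewrite /jacobi_pred oner_eq0 symplectic1. Qed.
Definition jacobi_one : J := mkjacobi jacobi_one_subproof.

Definition jacobi_mul_def (x y : triple) :=
  let: (b, a, M) := x in let: (b', a', M') := y in
  (b * b' * e (omega a (toC M *m a') / hbar), a + toC M *m a', M *m M').

Lemma jacobi_mul_subproof (x y : J) :
  jacobi_pred (jacobi_mul_def (val x) (val y)).
Proof.
case: x y => [[[b a] M] /andP[/= b0 sM]] [[[b' a'] M'] /andP[/= b0' sM']].
by rewrite /jacobi_pred /= !mulf_neq0 ?expmap_neq0 ?symplecticM.
Qed.
Definition jacobi_mul (x y : J) : J :=
  mkjacobi (jacobi_mul_subproof x y).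

Definition jacobi_inv_def (x : triple) :=
  let: (b, a, M) := x in (b^-1, - (toC (spinv M) *m a), spinv M).

Lemma jacobi_inv_subproof (x : J) : jacobi_pred (jacobi_inv_def (val x)).
Proof.
case: x => [[[b a] M] /andP[/= b0 sM]].
by rewrite /jacobi_pred /= invr_eq0 b0 symplecticV.
Qed.
Definition jacobi_inv (x : J) : J :=
  mkjacobi (jacobi_inv_subproof x).

Lemma jacobi_mulA : associative jacobi_mul.
Proof.
move=> x y z; apply: val_inj => /=.
case: x y z => [[[b a] M] /andP[/= _ sM]] [[[b' a'] M'] _] [[[b'' a''] M''] _] /=.
rewrite toCM mulmxDr !mulmxA addrA omegaDr omegaDl -!mulmxA.
rewrite omega_symplectic // !mulrDl !expmapD; congr (_, _, _).
by ring.
Qed.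

Lemma jacobi_mul1 : left_id jacobi_one jacobi_mul.
Proof.
move=> x; apply: val_inj; case: x => [[[b a] M] ?] /=.
by rewrite omega0l mul0r expmap0 mulr1 !mul1r add0r toC1 !mul1mx.
Qed.

Lemma jacobi_mulr1 : right_id jacobi_one jacobi_mul.
Proof.
move=> x; apply: val_inj; case: x => [[[b a] M] ?] /=.
by rewrite mulmx0 omega0r mul0r expmap0 !mulr1 addr0 mulmx1.
Qed.

Lemma jacobi_mulV : left_inverse jacobi_one jacobi_inv jacobi_mul.
Proof.
move=> x; apply: val_inj; case: x => [[[b a] M] /andP[/= b0 sM]] /=.
rewrite omegaC omegaNr opprK omegaaa mul0r expmap0 mulr1 mulVf //.
by rewrite addNr spinvK.
Qed.

Lemma jacobi_mulrV : right_inverse jacobi_one jacobi_inv jacobi_mul.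
Proof.
move=> x; apply: val_inj; case: x => [[[b a] M] /andP[/= b0 sM]] /=.
rewrite mulmxN mulmxA -toCM spinvKr // toC1 mul1mx omegaNr omegaaa oppr0.
by rewrite mul0r expmap0 mulr1 mulfV // subrr.
Qed.

HB.instance Definition _ := isGroup.Build J
  jacobi_mulA jacobi_mul1 jacobi_mulr1 jacobi_mulV jacobi_mulrV.

Lemma scal_subproof (b : K) : b != 0 -> jacobi_pred (b, 0, 1%:M).
Proof. by move=> b0; rewrite /jacobi_pred b0 symplectic1. Qed.

Definition scal b (b0 : b != 0) : J := mkjacobi (scal_subproof b0).

(* e^(a / hbar) *)
Lemma expL_subproof a : jacobi_pred (1, a, 1%:M).
Proof. by rewrite /jacobi_pred oner_eq0 symplectic1. Qed.
Definition expL a : J := mkjacobi (expL_subproof a).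

(* The factor M, if M is symplectic. *)
Definition linear_part (M : 'M[int]_(n + n)) : J :=
  insubd (1%g : J) (1, 0, M).

(* e^(f g / (2 hbar)), if [f, g] = 0. *)
Definition expQ (f g : 'cV[int]_(n + n)) : J := linear_part (expQ_mx f g).

Lemma val_linear_part M : symplectic M -> val (linear_part M) = (1, 0, M).
Proof.
by move=> sM; rewrite val_insubd /jacobi_pred /= oner_eq0 sM.
Qed.

Lemma expL_mul a a' :
  (expL a * expL a')%g
  = (scal (expmap_neq0 e (omega a a' / hbar)) * expL (a + a'))%g.
Proof.
apply: val_inj => /=.
by rewrite toC1 !mul1mx !mulr1 !mul1r omega0l mul0r expmap0 mulr1 add0r.
Qed.

Lemma linear_part_expL M a : symplectic M ->
  (linear_part M * expL a * (linear_part M)^-1)%g = expL (toC M *m a).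
Proof.
move=> sM; apply: val_inj; rewrite /= val_linear_part //=.
rewrite mulmx0 oppr0 mulmx0 omega0r omega0l !mul0r expmap0 invr1 !mulr1 add0r.
by rewrite addr0 mulmx1 spinvKr.
Qed.

Lemma linear_partM M M' : symplectic M -> symplectic M' ->
  linear_part (M *m M') = (linear_part M * linear_part M')%g.
Proof.
move=> sM sM'; apply: val_inj; rewrite /= !val_linear_part ?symplecticM //=.
by rewrite mulmx0 omega0r mul0r expmap0 !mulr1 addr0.
Qed.

Lemma expQD f g h : omega f g = 0 -> omega f h = 0 -> omega g h = 0 ->
  expQ f (g + h) = (expQ f g * expQ f h)%g.
Proof.
move=> fg fh gh; rewrite /expQ expQ_mxD //.
by rewrite linear_partM // symplectic_expQ.
Qed.

Lemma linear_part_expQ M f g : symplectic M -> omega f g = 0 ->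
  (linear_part M * expQ f g * (linear_part M)^-1)%g = expQ (M *m f) (M *m g).
Proof.
move=> sM fg; apply: (canLR (mulgK _)).
have sMfg : symplectic (expQ_mx (M *m f) (M *m g)).
  by apply: symplectic_expQ; rewrite omega_symplectic_int.
rewrite /expQ -!linear_partM //; last exact: symplectic_expQ.
congr linear_part; apply/eqP/mulmx_colP => x.
rewrite -!mulmxA !expQ_mxE !omega_symplectic_int // !mulmxDr.
by rewrite -!scalemxAr.
Qed.

(* s acts on N_n by permuting the indices of the canonical variables. *)
Definition permJ (s : 'S_n) (x : J) : J :=
  (linear_part (idx_mx s) * x * (linear_part (idx_mx s))^-1)%g.

Lemma permJ_expL s a : permJ s (expL a) = expL (toC (idx_mx s) *m a).
Proof. by rewrite /permJ linear_part_expL // symplectic_idx. Qed.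

Lemma permJ_expQ s f g : omega f g = 0 ->
  permJ s (expQ f g) = expQ (idx_mx s *m f) (idx_mx s *m g).
Proof. by move=> fg; rewrite /permJ linear_part_expQ // symplectic_idx. Qed.

Lemma permJM s x y : permJ s (x * y)%g = (permJ s x * permJ s y)%g.
Proof. by rewrite /permJ !mulgA mulgKV. Qed.

Lemma linear_part1 : linear_part 1%:M = 1%g.
Proof. by apply: val_inj; rewrite val_linear_part ?symplectic1. Qed.

Lemma permJ1 x : permJ 1 x = x.
Proof. by rewrite /permJ idx_mx1 linear_part1 invg1 mulg1 mul1g. Qed.

Lemma permJ_comp s t x : permJ (t * s) x = permJ s (permJ t x).
Proof.
rewrite /permJ idx_mxM linear_partM ?symplectic_idx //.
by rewrite invgM !mulgA.
Qed.

(* The semidirect product of jacobi and S_n. The group law of 'S_n in MathComp *)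
(* composes from left to right, whereas s t first permutes by t.               *)
Definition jacobiS := (J * 'S_n)%type.

HB.instance Definition _ := Choice.on jacobiS.

Definition jacobiS_one : jacobiS := (1, 1)%g.
Definition jacobiS_mul (x y : jacobiS) : jacobiS :=
  (x.1 * permJ x.2 y.1, y.2 * x.2)%g.
Definition jacobiS_inv (x : jacobiS) : jacobiS :=
  (permJ x.2^-1 x.1^-1, x.2^-1)%g.

Lemma jacobiS_mulA : associative jacobiS_mul.
Proof.
move=> x y z; rewrite /jacobiS_mul /= permJM permJ_comp.
by rewrite (mulgA z.2) mulgA.
Qed.

Lemma jacobiS_mul1 : left_id jacobiS_one jacobiS_mul.
Proof. by case=> x s; rewrite /jacobiS_mul /= permJ1 mul1g mulg1. Qed.

Lemma permJ_one s : permJ s 1%g = 1%g.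
Proof. by rewrite /permJ mulg1 mulgV. Qed.

Lemma jacobiS_mulr1 : right_id jacobiS_one jacobiS_mul.
Proof. by case=> x s; rewrite /jacobiS_mul /= permJ_one mul1g mulg1. Qed.

Lemma jacobiS_mulV : left_inverse jacobiS_one jacobiS_inv jacobiS_mul.
Proof.
by case=> x s; rewrite /jacobiS_mul /= -permJM mulVg permJ_one mulgV.
Qed.

Lemma jacobiS_mulrV : right_inverse jacobiS_one jacobiS_inv jacobiS_mul.
Proof.
by case=> x s; rewrite /jacobiS_mul /= -permJ_comp mulVg permJ1 mulgV.
Qed.

HB.instance Definition _ := isGroup.Build jacobiS
  jacobiS_mulA jacobiS_mul1 jacobiS_mulr1 jacobiS_mulV jacobiS_mulrV.

Definition ofJ (x : J) : jacobiS := (x, 1%g).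
Definition ofS (s : 'S_n) : jacobiS := (1%g, s).

(* The monomial c e^l of the q-Weyl algebra, l being an integral linear form.  *)
Definition qmono := (K * 'cV[int]_(n + n))%type.

Definition qmono_exp (c : K) (l : 'cV[int]_(n + n)) : qmono := (e c, l).

Definition qmono_mul (x y : qmono) : qmono :=
  (x.1 * y.1 * e hbar ^ omega x.2 y.2, x.2 + y.2).

Definition qmono_pow (x : qmono) (m : nat) : qmono :=
  iter m (qmono_mul x) (1, 0).

(* The adjoint action: e^(a / hbar) e^l e^(- a / hbar) = e^(2 (omega a l)) e^l. *)
Definition Ad (g : jacobiS) (x : qmono) : qmono :=
  let: (_, a, M) := val g.1 in
  let l := M *m (idx_mx g.2 *m x.2) in
  (x.1 * e (2 * omega a (toC l)), l).

Lemma Ad_conj (g : jacobiS) (l : 'cV[int]_(n + n))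
    (c0 : (Ad g (1, l)).1 != 0) : hbar != 0 ->
  (g * ofJ (expL (hbar *: toC l)) * g^-1)%g =
  ofJ (scal c0 * expL (hbar *: toC (Ad g (1%R, l)).2))%g.
Proof.
move=> h0; apply: (canLR (mulgK g)); move: c0.
case: g => [[[[b a] M] Hx] s] c0; have /andP[/= b0 sM] := Hx.
apply/eqP; rewrite /eq_op /=; apply/andP; split; last first.
  by rewrite mulg1 mul1g.
rewrite permJ1 permJ_expL; apply/eqP/val_inj => /=.
rewrite toC1 !mul1mx toC1 !mul1mx -!scalemxAr -!toCM omega0l mul0r expmap0.
set v := toC _; rewrite !add0r mulmx1 [a + _]addrC; congr (_, _, _).
rewrite omegaZr omegaZl !(mulrC hbar) !mulfK // [omega v a]omegaC.
rewrite mul1r !mulr1 mulrAC -expmapD mulrC; congr (e _ * _).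
by ring.
Qed.

End Jacobi.

Section QuantumDilogarithm.
Variables (K : fieldType) (q : K).

Definition qpochhammer (z p : K) (m : nat) := \prod_(k < m) (1 - z * p ^+ k).

(* The coefficients of Psi_q (for s = true) and Psi_q^-1 (for s = false). *)
Definition Psi_coef (s : bool) (m : nat) : K :=
  (if s then (- q) ^+ m else q ^+ (m ^ 2)) / qpochhammer (q ^+ 2) (q ^+ 2) m.

End QuantumDilogarithm.

Section Operators.
Variables (K : fieldType) (e : expmap K) (hbar : K) (n : nat).
Local Notation qmono := (qmono K n).

(* (true, Y) stands for Psi_q(Y) and (false, Y) for Psi_q(Y)^-1. *)
Definition factor := (bool * qmono)%type.

(* The term of multi-index ms in the expansion of a product of factors. *)
Definition expansion_term (fs : seq factor) (ms : seq nat) : qmono :=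
  foldr (qmono_mul e hbar) (1, 0)
    [seq let: (s, Y, m) := p in
         qmono_mul e hbar (Psi_coef (e hbar) s m, 0) (qmono_pow e hbar Y m)
    | p <- zip fs ms].

Definition expansion_fiber (fs : seq factor) (l : 'cV[int]_(n + n)) :=
  [set ms : (size fs).-tuple nat | (expansion_term fs ms).2 = l].

(* The expansion of a product of factors is a formal Laurent series if every   *)
(* monomial e^l receives finitely many contributions. The sum below is over a  *)
(* finite set in that case, and meaningless otherwise.                         *)
Definition expandable (fs : seq factor) :=
  forall l : 'cV[int]_(n + n), finite_set (@expansion_fiber fs l).

Definition expansion (fs : seq factor) (l : 'cV[int]_(n + n)) : K :=
  \sum_(ms \in @expansion_fiber fs l) (expansion_term fs ms).1.

(* A product of factors followed by an element of the semidirect product.      *)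
Definition qop := (seq factor * jacobiS n e hbar)%type.

Definition Psi (Y : qmono) : qop := ([:: (true, Y)], 1%g).
Definition PsiV (Y : qmono) : qop := ([:: (false, Y)], 1%g).
Definition qop_of (g : jacobiS n e hbar) : qop := ([::], g).

(* P Psi_q(x) = Psi_q(P x P^-1) P *)
Definition qop_mul (x y : qop) : qop :=
  (x.1 ++ [seq (f.1, Ad x.2 f.2) | f <- y.1], (x.2 * y.2)%g).

Definition qop_eq (x y : qop) :=
  [/\ expandable x.1, expandable y.1, expansion x.1 =1 expansion y.1
    & x.2 = y.2].

End Operators.
Arguments expansion_fiber {K} e hbar {n} fs l.

Notation "x ** y" := (qop_mul x y) (at level 40, left associativity).
Notation "x === y" := (qop_eq x y) (at level 70, no associativity).

Section ROperators.
Variables (K : fieldType) (e : expmap K) (hbar : K) (n : nat).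
Local Notation X := (@qmono_exp K n e).
Local Notation Psi := (@Psi K e hbar n).
Local Notation PsiV := (@PsiV K e hbar n).

Definition P_op (lj lk : K) (i j k : 'I_n) : jacobiS n e hbar :=
  (ofJ (expQ e hbar (u_ i - w_ i) (w_ j - w_ k)) * ofS e hbar (tperm j k)
   * ofJ (expL e hbar (((lj - lk) / 2) *: toC (u_ k - w_ i))))%g.

Definition R_op (li lj lk : K) (i j k : 'I_n) : qop e hbar n :=
  PsiV (X 0 (u_ k - w_ i)) ** PsiV (X lk (u_ k - w_ i - w_ j + w_ k))
  ** Psi (X li (u_ i - u_ j)) ** Psi (X (li - lk) (u_ i - u_ j + w_ j - w_ k))
  ** qop_of (P_op lj lk i j k).

Definition R_op' (li lj lk : K) (i j k : 'I_n) : qop e hbar n :=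
  PsiV (X lk (w_ k - w_ j)) ** PsiV (X 0 (u_ k - w_ i))
  ** qop_of (P_op lj lk i j k)
  ** Psi (X (li - lk) (w_ i - u_ k)) ** Psi (X lj (w_ j - w_ k)).

End ROperators.

(* Main.v *)
Require Import Defs.
From mathcomp Require Import all_boot all_order all_algebra all_fingroup.
From mathcomp Require Import complex reals.
From mathcomp Require Import boolp classical_sets cardinality fsbigop.
From mathcomp Require Import ring zify.

(* Let omega z be a linear form that is positive on the exponents of all the   *)
(* factors. The products of quantum dilogarithms act on the Laurent series     *)
(* supported in omega z >= 0, and the expansion of a product is the image of   *)
(* the constant series 1. So an identity of expansions follows from one of     *)
(* operators, for which there are the commutation relations, the cancellation  *)
(* of Psi_q(A) Psi_q(A)^-1, and the pentagon identity                          *)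
(*   Psi_q(A) Psi_q(B) = Psi_q(B) Psi_q(C) Psi_q(A)                            *)
(* for A = e^l, B = e^m, C = e^(l + m) with omega l m = 1. Two pentagons turn  *)
(* the first form of R into the second one, and sixteen turn one side of the   *)
(* tetrahedron equation into the other, starting from the second form, where   *)
(* Psi_q(B)^(-1) and Psi_q(B) conjugate Psi_q(A)^-1 Psi_q(D). The monomial     *)
(* parts are compared in the Jacobi group, after moving the exponentials of    *)
(* linear forms to the left.                                                   *)

Set Implicit Arguments.
Unset Strict Implicit.
Unset Printing Implicit Defensive.

Import Order.TTheory GRing.Theory Num.Theory.
Local Open Scope ring_scope.

(** * Coefficient identities of q-series *)

(** Once every [P_op] is moved to the right, each side is a word in quantum dilogarithms followed by
    a group element, and the two components are compared separately. For the words, one linear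
    functional positive on all exponents makes every dilogarithm an invertible operator on series
    supported in nonnegative degrees ([series], [psiK]), and applying a word to the constant series
    recovers its expansion ([expansionE]). The same positivity makes the expansion meaningful: the
    total degree bounds every summation index ([expansion_term_ge]).

    Two facts on coefficients give the relations. An alternating q-binomial sum vanishes, which
    inverts Psi_q ([Psi_coef_conv]). A q-Vandermonde sum collapses the threefold product of the
    pentagon identity to a twofold one ([Psi_coef_pentagon], [series_pentagon]). The two forms of R
    then differ by two pentagons ([psis_R_word]).

    The tetrahedron equation for words becomes a word problem over integer vectors, modulo
    commutation, cancellation and pentagons. An explicit chain of pentagons is checked by
    computation ([tetra_derives]) and carried over to operators by [derives_sound]. The group
    elements agree because their linear maps, their permutations and their Heisenberg parts, phases
    included, agree ([P_prod_tetra], [expL_tetra]). *)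

Section NatSums.
Variable V : nmodType.
Implicit Type F : nat -> V.

Lemma sum_nat_trunc F m n : (m <= n)%N ->
  (forall i, (m <= i)%N -> F i = 0) ->
  \sum_(0 <= i < n) F i = \sum_(0 <= i < m) F i.
Proof.
move=> mn F0; rewrite (big_cat_nat (leq0n _) mn) //= [X in _ + X]big_nat.
rewrite [X in _ + X]big1 ?addr0 //.
by move=> i /andP[/F0].
Qed.

Lemma sum_nat_shift F p n : (forall i, (n <= i + p)%N -> F i = 0) ->
  \sum_(0 <= i < n) F i = \sum_(0 <= s < n) if (p <= s)%N then F (s - p)%N else 0.
Proof.
move=> F0; have [pn|/ltnW np] := leqP p n; last first.
  rewrite !big_nat !big1 // => i /andP[_ ni].
    by rewrite leqNgt (leq_trans ni).
  by apply: F0; rewrite (leq_trans np) ?leq_addl.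
rewrite [RHS](big_cat_nat (leq0n _) pn) //= [X in _ = X + _]big_nat.
rewrite [X in _ = X + _]big1 ?add0r; last first.
  by move=> i /andP[_ ip]; rewrite leqNgt ip.
rewrite -[X in _ = \big[_/_]_(X <= i < n | _) _]add0n big_addn.
rewrite (@sum_nat_trunc _ (n - p)) ?leq_subr //.
  by apply: eq_bigr => i _; rewrite leq_addl addnK.
by move=> i; rewrite leq_subLR addnC; exact: F0.
Qed.

(** Regrouping by s = i + j: the part of the square beyond the diagonal contributes nothing. *)
Lemma sum_nat_diagonal (H : nat -> nat -> V) n :
  (forall i j, (n <= i + j)%N -> H i j = 0) ->
  \sum_(0 <= i < n) \sum_(0 <= j < n) H i j =
  \sum_(0 <= s < n) \sum_(0 <= i < s.+1) H i (s - i)%N.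
Proof.
move=> H0; under eq_bigr => i _.
  rewrite (@sum_nat_shift _ i) => [|j]; last by rewrite addnC; exact: H0.
  over.
rewrite exchange_big_nat /= [LHS]big_nat [RHS]big_nat.
apply: eq_bigr => s /andP[_ sn].
rewrite (@sum_nat_trunc _ s.+1) //.
  by rewrite !big_nat; apply: eq_bigr => i /andP[_]; rewrite ltnS => ->.
by move=> i si; rewrite leqNgt si.
Qed.

End NatSums.

Section QSeries.
Variables (K : fieldType) (t : K).
Hypothesis t_generic : not_root_of_unity t.
Local Notation poch := (qpochhammer t t).

Lemma qpochhammerS m : poch m.+1 = poch m * (1 - t ^+ m.+1).
Proof. by rewrite /qpochhammer big_ord_recr /= -exprS. Qed.

Lemma qpochhammer0 : poch 0 = 1.
Proof. by rewrite /qpochhammer big_ord0. Qed.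

Lemma subr_expr_neq0 m : 1 - t ^+ m.+1 != 0.
Proof. by rewrite subr_eq0 eq_sym t_generic. Qed.

Lemma qpochhammer_neq0 m : poch m != 0.
Proof.
elim: m => [|m IHm]; first by rewrite qpochhammer0 oner_eq0.
by rewrite qpochhammerS mulf_neq0 // subr_expr_neq0.
Qed.

(** The coefficient of x^p in prod_(k < n) (1 - x t^k), by the q-binomial theorem, divided by
    [poch n]. *)
Definition alt_coef (n p : nat) : K :=
  (-1) ^+ p * t ^+ 'C(p, 2) / (poch p * poch (n - p)).

(* The split 1 - t^(n+1) = (1 - t^p) + t^p (1 - t^(n+1-p)) and a shift of p in *)
(* the first part.                                                             *)
Lemma alt_sum_rec (g : nat -> K) n :
  (1 - t ^+ n.+1) * \sum_(0 <= p < n.+2) alt_coef n.+1 p * g p =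
  \sum_(0 <= p < n.+1) alt_coef n p * (t ^+ p * (g p - g p.+1)).
Proof.
have p0 := qpochhammer_neq0; have e0 := subr_expr_neq0.
pose A p := (1 - t ^+ p) * (alt_coef n.+1 p * g p).
pose B p := t ^+ p * (1 - t ^+ (n.+1 - p)) * (alt_coef n.+1 p * g p).
transitivity (\sum_(0 <= p < n.+2) A p + \sum_(0 <= p < n.+2) B p).
  rewrite mulr_sumr -big_split /= !big_nat; apply: eq_bigr => p /andP[_ pn].
  rewrite /A /B -mulrDl; congr (_ * _).
  by rewrite mulrBr mulr1 -exprD subnKC // addrA subrK.
rewrite big_nat_recl // {1}/A expr0 subrr mul0r add0r.
rewrite [X in _ + X]big_nat_recr //= {2}/B subnn expr0 subrr mulr0 mul0r addr0.
rewrite -big_split /= !big_nat; apply: eq_bigr => p /andP[_ pn].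
rewrite /A /B /alt_coef subSS subSn // !qpochhammerS !exprS.
have := p0 p; have := p0 (n - p)%N; have := e0 p; have := e0 (n - p)%N.
rewrite binS bin1 exprD !exprS => ? ? ? ?; field.
by apply/and4P.
Qed.

(** A constant g has zero differences in [alt_sum_rec]. *)
Lemma alt_sum_eq0 n : \sum_(0 <= p < n.+2) alt_coef n.+1 p = 0.
Proof.
have /eqP := alt_sum_rec (fun=> 1) n.
rewrite [X in _ == X]big1 => [|p _]; last by rewrite subrr !mulr0.
rewrite mulf_eq0 (negbTE (subr_expr_neq0 _)) /= => /eqP S0.
by rewrite -[RHS]S0; apply: eq_bigr => p _; rewrite mulr1.
Qed.

(** A q-Vandermonde sum, by induction on n through [alt_sum_rec]. *)
Lemma alt_sum_vandermonde m n :
  \sum_(0 <= p < n.+1)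
    (if (p <= m)%N then alt_coef n p / poch (m - p) else 0) =
  t ^+ (m * n) / (poch m * poch n).
Proof.
have p0 := qpochhammer_neq0; have e0 := subr_expr_neq0.
pose g p := if (p <= m)%N then (poch (m - p))^-1 else 0.
(* g is an eigenvector of the difference operator of [alt_sum_rec] for the eigenvalue t^m; its value
   0 beyond m makes this hold at p = m too. *)
have gS p : t ^+ p * (g p - g p.+1) = t ^+ m * g p.
  rewrite /g; have [pm|mp|->] := ltngtP p m; last 2 first.
  - by rewrite subrr !mulr0.
  - by rewrite subr0.
  have -> : t ^+ m = t ^+ p * t ^+ (m - p.+1).+1.
    by rewrite -exprD addnS -addSn subnKC.
  rewrite -(subnSK pm) qpochhammerS.
  have := p0 (m - p.+1)%N; have := e0 (m - p.+1)%N.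
  by move=> ? ?; field; apply/andP.
transitivity (\sum_(0 <= p < n.+1) alt_coef n p * g p).
  by apply: eq_bigr => p _; rewrite /g; case: ifP; rewrite ?mulr0.
elim: n => [|n IHn].
  rewrite big_nat1 /alt_coef /g /= subn0 muln0 bin0n qpochhammer0 !expr0.
  by rewrite !mul1r invr1 subn0 mulr1 mul1r.
apply: (mulfI (e0 n)); rewrite alt_sum_rec.
under eq_bigr => p _ do rewrite gS mulrCA.
rewrite -mulr_sumr IHn qpochhammerS mulnS exprD.
by have := p0 m; have := p0 n; have := e0 n => ? ? ?; field; apply/and3P.
Qed.

End QSeries.

(** * Quantum dilogarithms as operators on Laurent series *)

Section OmegaNat.
Variables (n : nat).
Implicit Types x y : 'cV[int]_(n + n).

Lemma omegaBr x y y' : omega x (y - y') = omega x y - omega x y'.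
Proof. by rewrite omegaDr omegaNr. Qed.

Lemma omegaMnr x y m : omega x (y *+ m) = omega x y * m%:Z.
Proof.
elim: m => [|m IHm]; first by rewrite mulr0n omega0r mulr0.
by rewrite mulrSr omegaDr IHm intS mulrDr mulr1 addrC.
Qed.

End OmegaNat.

Lemma ler_natM_pos (d : int) (m : nat) : 0 < d -> m%:Z <= d * m%:Z.
Proof. by move=> d0; rewrite ler_peMl //; lia. Qed.

Section Series.
Variables (K : fieldType) (q : K) (n : nat).
Hypotheses (q_generic : not_root_of_unity q) (q_neq0 : q != 0).
Variable z : 'cV[int]_(n + n).
Local Notation lform := 'cV[int]_(n + n).
Local Notation qmono := (qmono K n).

(* Laurent series in the e^l, those with omega z l < 0 not occurring *)
Record laurent := Laurent {
  lcoef :> lform -> K;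
  lcoef0 : forall x, omega z x < 0 -> lcoef x = 0 }.

Lemma laurentP (f g : laurent) : lcoef f =1 lcoef g -> f = g.
Proof.
case: f g => [f f0] [g g0] /= /funext fg; case: _ / fg g0 => g0.
by congr Laurent; exact: Prop_irrelevance.
Qed.

(** The coefficient of e^x in c_m Y^m f. For l the exponent of Y, the power of q comes from e^(m l)
    e^(x - m l) = q^(m omega(l, x)) e^x, as omega(l, l) = 0. *)
Definition series_term (c : nat -> K) (Y : qmono) (f : lform -> K) x m :=
  c m * Y.1 ^+ m * q ^ (omega Y.2 x * m%:Z) * f (x - Y.2 *+ m).

(** If Y has positive degree, the terms with m above the degree of x vanish, so that the truncation
    loses nothing; for other Y the value is a mere default. *)
Lemma series_subproof c Y f x : omega z x < 0 ->
  (if 0 <= omega z x then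
     \sum_(0 <= m < `|omega z x|.+1) series_term c Y f x m else 0) = 0.
Proof. by rewrite ltNge => /negbTE ->. Qed.

(* The product (sum_m c m Y^m) f *)
Definition series c Y (f : laurent) : laurent := Laurent (@series_subproof c Y f).

(** The freedom in N lets nested series be summed over a common box. *)
Lemma seriesE c Y (f : laurent) x N : 0 < omega z Y.2 -> omega z x < N%:Z ->
  series c Y f x = \sum_(0 <= m < N) series_term c Y f x m.
Proof.
move=> Y0 xN; have t0 m : omega z x < m%:Z -> series_term c Y f x m = 0.
  move=> xm; rewrite /series_term (lcoef0 f) ?mulr0 // omegaBr omegaMnr.
  by rewrite subr_lt0 (lt_le_trans xm) // ler_natM_pos.
rewrite /series /=; case: ifPn => [x0|]; last first.
  by rewrite -ltNge => x0; rewrite big1_seq // => m _; apply: t0; lia.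
rewrite [RHS](@sum_nat_trunc _ _ `|omega z x|.+1) //; first lia.
by move=> i ?; apply: t0; lia.
Qed.

Lemma laurentP_nneg (f g : laurent) :
  (forall x N, 0 <= omega z x -> omega z x < N%:Z -> f x = g x) -> f = g.
Proof.
move=> fg; apply: laurentP => x; have [x0|x0] := ltP (omega z x) 0.
  by rewrite !lcoef0.
by apply: (fg _ `|omega z x|.+1) => //; lia.
Qed.

Lemma series2E c Y c' Y' (f : laurent) x N :
  0 < omega z Y.2 -> 0 < omega z Y'.2 -> omega z x < N%:Z ->
  series c Y (series c' Y' f) x =
  \sum_(0 <= m < N) \sum_(0 <= m' < N)
    c m * c' m' * (Y.1 ^+ m * Y'.1 ^+ m') *
    q ^ (omega Y.2 x * m%:Z + omega Y'.2 x * m'%:Z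
         - omega Y'.2 Y.2 * (m%:Z * m'%:Z)) *
    f (x - (Y.2 *+ m + Y'.2 *+ m')).
Proof.
move=> Y0 Y0' xN; rewrite (seriesE _ _ Y0 xN); apply: eq_bigr => m _.
rewrite /series_term (@seriesE _ _ _ _ N) //; last first.
  by rewrite omegaBr omegaMnr ltrBlDr (lt_le_trans xN) // lerDl mulr_ge0 // ltW.
rewrite mulr_sumr; apply: eq_bigr => m' _; rewrite /series_term.
rewrite opprD addrA omegaBr omegaMnr.
rewrite (_ : omega Y.2 x * _ + _ - _ = omega Y.2 x * m%:Z +
  (omega Y'.2 x - omega Y'.2 Y.2 * m%:Z) * m'%:Z); last by ring.
rewrite expfzDr //; set a := q ^ _; set b := q ^ _; set g := f _.
by move: (_ ^+ _) (_ ^+ _) a b g => *; ring.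
Qed.

Lemma seriesC c Y c' Y' f :
  0 < omega z Y.2 -> 0 < omega z Y'.2 -> omega Y.2 Y'.2 = 0 ->
  series c Y (series c' Y' f) = series c' Y' (series c Y f).
Proof.
move=> Y0 Y0' YY'; apply: laurentP_nneg => x N _ xN.
rewrite !(series2E _ _ _ _ _ xN) // exchange_big_nat /=.
apply: eq_bigr => m' _; apply: eq_bigr => m _.
have Y'Y : omega Y'.2 Y.2 = 0 by rewrite omegaC YY' oppr0.
rewrite YY' Y'Y !mul0r !subr0 [_ *+ m + _]addrC [omega Y.2 x * _ + _]addrC.
by congr (_ * _ * _); rewrite (mulrC (c m)) (mulrC (_ ^+ m)).
Qed.

(** Powers of one monomial multiply without powers of q, so the coefficients form a Cauchy
    product. *)
Lemma series_diag c c' Y (f : laurent) x N :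
  0 < omega z Y.2 -> omega z x < N%:Z ->
  series c Y (series c' Y f) x =
  \sum_(0 <= s < N) (\sum_(0 <= i < s.+1) c i * c' (s - i)%N) *
    (Y.1 ^+ s * q ^ (omega Y.2 x * s%:Z) * f (x - Y.2 *+ s)).
Proof.
move=> Y0 xN; rewrite (series2E _ _ _ Y0 Y0 xN) sum_nat_diagonal; last first.
  move=> i j ij; rewrite (lcoef0 f) ?mulr0 // -mulrnDr omegaBr omegaMnr subr_lt0.
  by rewrite (lt_le_trans xN) // (le_trans _ (ler_natM_pos _ Y0)) // lez_nat.
rewrite [LHS]big_nat [RHS]big_nat; apply: eq_bigr => s _.
rewrite !big_nat mulr_suml; apply: eq_bigr => i /andP[_ /ltnSE si].
rewrite -mulrnDr -exprD omegaaa mul0r subr0 -mulrDr -PoszD subnKC //.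
by rewrite !mulrA.
Qed.

Lemma series_unit c c' Y (f : laurent) : 0 < omega z Y.2 ->
  (forall s, \sum_(0 <= i < s.+1) c i * c' (s - i)%N = (s == 0%N)%:R) ->
  series c Y (series c' Y f) = f.
Proof.
move=> Y0 cc'; apply: laurentP_nneg => x [|N] x0 xN; first lia.
rewrite (series_diag _ _ _ Y0 xN) big_nat_recl // cc' big1 => [|s _].
  by rewrite expr0 mulr0 expr0z !mul1r subr0 addr0.
by rewrite cc' mul0r.
Qed.

(** Matches the q^(i^2) in Psi_q^-1 with the binomial exponent in [alt_coef] at t = q^2. *)
Lemma sqr_bin2 i : (i ^ 2 = 2 * 'C(i, 2) + i)%N.
Proof. by elim: i => // i IHi; rewrite binS bin1; nia. Qed.

Lemma sqr_generic : not_root_of_unity (q ^+ 2).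
Proof. by move=> m m0; rewrite -exprM q_generic // muln_gt0. Qed.

Local Notation c_ := (Psi_coef q).
Local Notation poch := (qpochhammer (q ^+ 2) (q ^+ 2)).
Local Notation alt := (alt_coef (q ^+ 2)).

Lemma Psi_coef_conv s :
  \sum_(0 <= i < s.+1) c_ false i * c_ true (s - i)%N = (s == 0%N)%:R.
Proof.
transitivity ((- q) ^+ s * \sum_(0 <= i < s.+1) alt s i).
  rewrite mulr_sumr !big_nat; apply: eq_bigr => i /andP[_ /ltnSE si].
  rewrite /Psi_coef /alt_coef sqr_bin2 exprD -exprM.
  have -> : (- q) ^+ s = (-1) ^+ i * q ^+ i * (- q) ^+ (s - i).
    by rewrite -exprMn mulN1r -exprD subnKC.
  rewrite mulf_div !mulrA; congr (_ / _).
  have aa : (-1) ^+ i * (-1) ^+ i = 1 :> K by rewrite -expr2 sqrr_sign.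
  move: (_ ^+ i) aa => a aa; move: (_ ^+ _) (_ ^+ _) (_ ^+ _) => b c d.
  by rewrite -[LHS]mul1r -aa; ring.
case: s => [|s]; last by rewrite alt_sum_eq0 ?mulr0 //; exact: sqr_generic.
by rewrite big_nat1 /alt_coef !expr0 qpochhammer0 !mul1r invr1.
Qed.

(** The pentagon identity at total exponents r of A and s of B: p is the exponent of C, which leaves
    r - p for A and s - p for B. After normalization of the powers of q it is [alt_sum_vandermonde]
    at t = q^2. *)
Lemma Psi_coef_pentagon r s :
  \sum_(0 <= p < s.+1) (if (p <= r)%N then
     c_ true (s - p)%N * c_ true p * c_ true (r - p)%N *
     q ^- ((s - p) * p + (r - p) * s) else 0) =
  c_ true r * c_ true s * q ^+ (r * s).
Proof.
transitivity ((- q) ^+ (r + s) / q ^+ (r * s) * \sum_(0 <= p < s.+1)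
    if (p <= r)%N then alt s p / poch (r - p) else 0).
  rewrite mulr_sumr !big_nat; apply: eq_bigr => p /andP[_ /ltnSE ps].
  case: ifP => [pr|_]; last by rewrite mulr0.
  move: ps pr => /subnK; set s' := (s - p)%N => <- /subnK.
  set r' := (r - p)%N => <-.
  have -> : ((r' + p) * (s' + p) = s' * p + r' * (s' + p) + p ^ 2)%N by ring.
  rewrite /Psi_coef /alt_coef addnK sqr_bin2 -exprM !exprD.
  have -> : (- q) ^+ p = (-1) ^+ p * q ^+ p by rewrite -exprMn mulN1r.
  rewrite [RHS](_ : _ = (- q) ^+ r' * (- q) ^+ s' * ((-1) ^+ p * q ^+ p) *
    ((-1) ^+ p * (-1) ^+ p) / (q ^+ (s' * p) * q ^+ (r' * (s' + p))) /
     (poch p * poch s' * poch r')); last first.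
    have := @qpochhammer_neq0 _ _ sqr_generic.
    by move=> p0; field; rewrite !p0 !expf_neq0.
  have -> : (-1) ^+ p * (-1) ^+ p = 1 :> K by rewrite -expr2 sqrr_sign.
  by rewrite mulr1 !invfM; ring.
rewrite alt_sum_vandermonde; last exact: sqr_generic.
rewrite /Psi_coef -exprM mul2n -addnn !exprD invfM.
have := expf_neq0 (r * s) q_neq0 => ?; have p0 := @qpochhammer_neq0 _ _ sqr_generic.
by field; rewrite !p0 !expf_neq0.
Qed.

Lemma series_pentagon (A B : qmono) (f : laurent) :
  0 < omega z A.2 -> 0 < omega z B.2 -> omega A.2 B.2 = 1 ->
  series (c_ true) A (series (c_ true) B f) =
  series (c_ true) B (series (c_ true) (A.1 * B.1, A.2 + B.2)
    (series (c_ true) A f)).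
Proof.
move=> A0 B0 AB; apply: laurentP_nneg => x N x0 xN.
have BA : omega B.2 A.2 = -1 by rewrite omegaC AB.
set C := (_, _); have C0 : 0 < omega z C.2 by rewrite omegaDr addr_gt0.
(* The term of B^k C^p A^r on the right-hand side, which has total exponents r + p of A and k + p of
   B. *)
pose G k p r := c_ true k * c_ true p * c_ true r *
  q ^- (k * p + r * (k + p)) *
  (A.1 ^+ (r + p) * B.1 ^+ (k + p) *
   q ^ (omega A.2 x * (r + p)%N%:Z + omega B.2 x * (k + p)%N%:Z) *
   f (x - (A.2 *+ (r + p) + B.2 *+ (k + p)))).
have G0 k p r : (N <= k + p)%N || (N <= r + p)%N -> G k p r = 0.
  move=> Nkpr; rewrite /G (lcoef0 f) ?mulr0 // omegaBr omegaDr !omegaMnr subr_lt0.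
  rewrite (lt_le_trans xN) //.
  have [kA rB] := (ler_natM_pos (r + p) A0, ler_natM_pos (k + p) B0).
  by rewrite (le_trans _ (lerD kA rB)) // -PoszD lez_nat; lia.
transitivity (\sum_(0 <= k < N) \sum_(0 <= p < N) \sum_(0 <= r < N) G k p r);
    last first.
  rewrite (seriesE _ _ B0 xN); apply: eq_bigr => k _; rewrite /series_term.
  rewrite (@series2E _ _ _ _ _ _ N) //; last first.
    by rewrite omegaBr omegaMnr ltrBlDr (lt_le_trans xN) // lerDl mulr_ge0 // ltW.
  rewrite mulr_sumr; apply: eq_bigr => p _.
  rewrite mulr_sumr; apply: eq_bigr => r _; rewrite /G /C /=.
  have -> : x - (A.2 *+ (r + p) + B.2 *+ (k + p)) =
            x - B.2 *+ k - ((A.2 + B.2) *+ p + A.2 *+ r).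
    rewrite !mulrnDr mulrnDl.
    move: (A.2 *+ r) (A.2 *+ p) (B.2 *+ k) (B.2 *+ p) => a b c d.
    by apply/matrixP => i j; rewrite !mxE; ring.
  have -> : omega (A.2 + B.2) (x - B.2 *+ k) = omega A.2 x + omega B.2 x - k%:Z.
    by rewrite omegaBr omegaMnr !omegaDl AB omegaaa; ring.
  have -> : omega A.2 (x - B.2 *+ k) = omega A.2 x - k%:Z.
    by rewrite omegaBr omegaMnr AB mul1r.
  have -> : omega A.2 (A.2 + B.2) = 1 by rewrite omegaDr AB omegaaa add0r.
  rewrite exprnN exprMn !exprD; set g := f _.
  rewrite (_ : - _%:Z = - (k%:Z * p%:Z + r%:Z * (k%:Z + p%:Z))); last by lia.
  set e1 := omega B.2 x * k%:Z; set e2 := _ + _ - 1 * _.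
  set e3 := - _; set e4 := omega A.2 x * _ + _.
  have : q ^ e1 * q ^ e2 = q ^ e3 * q ^ e4.
    rewrite -!(expfzDr _ _ q_neq0); congr (q ^ _).
    by rewrite /e1 /e2 /e3 /e4 !PoszD; ring.
  move: (q ^ e1) (q ^ e2) (q ^ e3) (q ^ e4) => h1 h2 h3 h4 h1234.
  move: (A.1 ^+ r) (A.1 ^+ p) (B.1 ^+ k) (B.1 ^+ p) => ar ap bk bp.
  move: (c_ true k) (c_ true p) (c_ true r) g => ck cp cr g.
  transitivity (h3 * h4 * (ck * cp * cr * (ar * ap * (bk * bp)) * g)).
    by ring.
  by rewrite -h1234; ring.
rewrite (series2E _ _ _ A0 B0 xN) [LHS]exchange_big_nat [RHS]exchange_big_nat /=.
(* From here on s and r are the total exponents of B and A, so that the sum over p for fixed s and r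
   is that of [Psi_coef_pentagon]. *)
transitivity (\sum_(0 <= p < N) \sum_(0 <= s < N) \sum_(0 <= r < N)
    if (p <= s)%N && (p <= r)%N then G (s - p)%N p (r - p)%N else 0); last first.
  apply: eq_bigr => p _; rewrite [RHS](@sum_nat_shift _ _ p); last first.
    by move=> k kN; rewrite big1 // => r _; rewrite G0 // kN.
  apply: eq_bigr => s _; case: leqP => ps /=; last by rewrite big1.
  by rewrite [RHS](@sum_nat_shift _ _ p) // => r rN; rewrite G0 // rN orbT.
rewrite [RHS]exchange_big_nat /= [LHS]big_nat [RHS]big_nat.
apply: eq_bigr => s /andP[_ sN]; rewrite [RHS]exchange_big_nat /=.
apply: eq_bigr => r _; rewrite (@sum_nat_trunc _ _ s.+1) //; last first.
  by move=> p sp; rewrite leqNgt sp.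
rewrite BA mulN1r opprK expfzDr //; set qx := q ^ (_ + _); set g := f _.
transitivity ((c_ true r * c_ true s * q ^+ (r * s)) *
    (A.1 ^+ r * B.1 ^+ s * qx * g)).
  by rewrite -PoszM -exprnP; move: qx g => *; ring.
rewrite -Psi_coef_pentagon mulr_suml !big_nat.
apply: eq_bigr => p /andP[_ /ltnSE ps]; rewrite ps /=; case: leqP => pr; last by rewrite mul0r.
by rewrite /G !subnK // -/g.
Qed.

End Series.

(** * Expansions of words as images of the constant series *)

Section TupleBox.
Local Open Scope nat_scope.

(** An explicit duplicate-free list containing the fibers of the expansion, which turns their
    finitely supported sums into ordinary ones. *)
Fixpoint tuple_box N k : seq (k.-tuple nat) :=
  if k is k'.+1 return seq (k.-tuple nat) then
    [seq cons_tuple m ms | m <- index_iota 0 N, ms <- tuple_box N k']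
  else [:: [tuple]].

Lemma tuple_box_uniq N k : uniq (tuple_box N k).
Proof.
elim: k => //= k IHk; apply: allpairs_uniq => //; first exact: iota_uniq.
move=> [m ms] [m' ms'] _ _ /(congr1 val) /= [-> msE].
by congr pair; apply: val_inj.
Qed.

Lemma mem_tuple_box N k (ms : k.-tuple nat) :
  (ms \in tuple_box N k) = all (fun m => m < N) ms.
Proof.
elim: k ms => [|k IHk] ms; first by rewrite tuple0 mem_seq1 eqxx.
case/tupleP: ms => m ms; rewrite /= -IHk; apply/allpairsP/andP.
  case=> -[m' ms'] /= [+ ? /(congr1 val) [-> mse]]; rewrite mem_index_iota.
  by have -> : ms = ms' by apply: val_inj.
by case=> mN msN; exists (m, ms); rewrite mem_index_iota.
Qed.

End TupleBox.

Section Words.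
Variables (K : fieldType) (e : expmap K) (hbar : K) (n : nat).
Local Notation q := (e hbar).
Hypothesis q_generic : not_root_of_unity q.
Variable z : 'cV[int]_(n + n).
Local Notation lform := 'cV[int]_(n + n).
Local Notation qmono := (qmono K n).
Local Notation factor := (factor K n).
Local Notation laurent := (laurent K z).
Implicit Types (a b : factor) (fs : seq factor).

Definition pos_factor a := 0 < omega z a.2.2.

Definition psi a : laurent -> laurent := series q (Psi_coef q a.1) a.2.

Definition psis fs (f : laurent) : laurent := foldr psi f fs.

Definition inv_factor a : factor := (~~ a.1, a.2).

Definition inv_factors fs := rev (map inv_factor fs).

Let q_neq0 : q != 0 := expmap_neq0 e hbar.

Lemma psi_comm a b f : pos_factor a -> pos_factor b -> omega a.2.2 b.2.2 = 0 ->
  psi a (psi b f) = psi b (psi a f).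
Proof. by move=> *; exact: seriesC. Qed.

(** The coefficient identity gives one order of the product; the other follows since series in the
    same monomial commute. *)
Lemma psiK a : pos_factor a -> cancel (psi a) (psi (inv_factor a)).
Proof.
have V Y (f : laurent) : 0 < omega z Y.2 ->
    psi (false, Y) (psi (true, Y) f) = f.
  by move=> Y0; apply: series_unit => // s; apply: Psi_coef_conv.
case: a => [[] Y] Y0 f; first exact: V.
by rewrite psi_comm ?V ?omegaaa.
Qed.

Lemma psis_cat fs fs' f : psis (fs ++ fs') f = psis fs (psis fs' f).
Proof. exact: foldr_cat. Qed.

Lemma inv_factors_cons a fs :
  inv_factors (a :: fs) = rcons (inv_factors fs) (inv_factor a).
Proof. by rewrite /inv_factors /= rev_cons. Qed.

Lemma psisK fs : all pos_factor fs -> cancel (psis fs) (psis (inv_factors fs)).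
Proof.
elim: fs => //= a fs IHfs /andP[a0 fs0] f.
by rewrite inv_factors_cons -cats1 psis_cat /= psiK // IHfs.
Qed.

Lemma pos_factor_inv_factors fs :
  all pos_factor (inv_factors fs) = all pos_factor fs.
Proof. by rewrite /inv_factors all_rev all_map; apply: eq_all. Qed.

(** A rotation of a word is its conjugate by an invertible prefix. *)
Lemma psis_rot m fs : all pos_factor fs ->
  (forall f, psis fs f = f) -> forall f, psis (rot m fs) f = f.
Proof.
rewrite -{1 2}(cat_take_drop m fs) all_cat => /andP[t0 d0] fs1 f.
rewrite /rot psis_cat; apply: (can_inj (psisK t0)).
by rewrite -[LHS]psis_cat fs1.
Qed.

Lemma qmono_powE (Y : qmono) m : qmono_pow e hbar Y m = (Y.1 ^+ m, Y.2 *+ m).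
Proof.
elim: m => //= m IHm; rewrite {}IHm /qmono_mul /= omegaMnr omegaaa mul0r expr0z.
by rewrite mulr1 -exprS -mulrS.
Qed.

Lemma expansion_term_cons a fs m ms (t := expansion_term e hbar fs ms) :
  expansion_term e hbar (a :: fs) (m :: ms) =
  (Psi_coef q a.1 m * a.2.1 ^+ m * t.1 * q ^ (omega a.2.2 t.2 * m%:Z),
   a.2.2 *+ m + t.2).
Proof.
case: a => s Y; rewrite {1}/expansion_term /= -/(expansion_term e hbar fs ms) -/t.
rewrite qmono_powE /qmono_mul /= omega0l expr0z mulr1 add0r.
by rewrite [omega (_ *+ _) _]omegaC omegaMnr -mulNr -omegaC.
Qed.

(** Each factor has degree at least 1, so its exponent is at most its own contribution to the
    degree, and the other contributions are nonnegative. *)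
Lemma expansion_term_ge fs ms m : all pos_factor fs -> size ms = size fs ->
  m \in ms -> m%:Z <= omega z (expansion_term e hbar fs ms).2.
Proof.
move=> + sz; have ge0 : forall fs ms, all pos_factor fs -> size ms = size fs ->
    0 <= omega z (expansion_term e hbar fs ms).2.
  elim=> [|a fs' IHfs] [|m' ms'] //; first by rewrite omega0r.
  move=> /andP[a0 fs0] /eq_add_S msz.
  rewrite expansion_term_cons omegaDr omegaMnr.
  by rewrite addr_ge0 ?IHfs // mulr_ge0 // ltW.
elim: fs ms sz => [|a fs' IHfs] [|m' ms'] // /eq_add_S msz /andP[a0 fs0].
rewrite expansion_term_cons omegaDr omegaMnr inE => /predU1P[->|mms].
  by rewrite (le_trans (ler_natM_pos _ a0)) // lerDl ge0.
by rewrite (le_trans (IHfs _ msz fs0 mms)) // lerDr mulr_ge0 // ltW.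
Qed.

Lemma expansion_fiber_box fs l N : all pos_factor fs -> omega z l < N%:Z ->
  (expansion_fiber e hbar fs l `<=` [set` tuple_box N (size fs)])%classic.
Proof.
move=> fs0 lN ms /= msl; rewrite mem_tuple_box; apply/allP => m mms.
have := expansion_term_ge fs0 (size_tuple ms) mms.
by rewrite -ltz_nat msl => /le_lt_trans; apply.
Qed.

Lemma expandable_pos_factor fs : all pos_factor fs -> expandable e hbar fs.
Proof.
move=> fs0 l; apply: (@sub_finite_set _ _
  [set` tuple_box `|omega z l|.+1 (size fs)]%classic); last exact: finite_seq.
by apply: expansion_fiber_box => //; lia.
Qed.

Lemma delta0_subproof (x : lform) : omega z x < 0 -> (x == 0)%:R = 0 :> K.
Proof. by have [->|] := eqVneq x 0; rewrite ?omega0r ?ltxx. Qed.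

Definition delta0 : laurent := Laurent delta0_subproof.

(** Every factor adds one summation index; an index of N or more would only reach degrees above that
    of l. *)
Lemma psis_delta0 fs l N : all pos_factor fs -> omega z l < N%:Z ->
  psis fs delta0 l = \sum_(ms <- tuple_box N (size fs) |
    (expansion_term e hbar fs ms).2 == l) (expansion_term e hbar fs ms).1.
Proof.
elim: fs l => [|a fs IHfs] l.
  by rewrite big_mkcond big_seq1 /expansion_term /= eq_sym; case: eqVneq.
move=> /andP[a0 fs0] lN; rewrite big_mkcond [tuple_box _ _]/= big_allpairs_dep.
rewrite [LHS](seriesE _ _ _ a0 lN); last exact: q_neq0. apply: eq_bigr => m _.
rewrite /series_term -/(psis fs delta0) IHfs //; last first.
  by rewrite omegaBr omegaMnr ltrBlDr (lt_le_trans lN) // lerDl mulr_ge0 // ltW.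
rewrite mulr_sumr [LHS]big_mkcond; apply: eq_bigr => ms _.
rewrite expansion_term_cons [(_, _).1]/= [(_, _).2]/=.
rewrite [_ == l - _]eq_sym subr_eq [_.2 + _]addrC [l == _]eq_sym.
case: eqP => // <-; rewrite omegaDr omegaMnr omegaaa mul0r ?addr0 ?add0r.
by rewrite mulrAC.
Qed.

Lemma expansionE fs l : all pos_factor fs ->
  expansion e hbar fs l = psis fs delta0 l.
Proof.
move=> fs0; have lN : omega z l < `|omega z l|.+1%:Z by lia.
rewrite (psis_delta0 fs0 lN) bigfs ?tuple_box_uniq //.
  by apply: eq_fsbigl; apply/seteqP; split => ms /=; move/eqP.
move=> ms /eqP msl; have := @expansion_fiber_box fs l _ fs0 lN ms msl.
by rewrite /= => ->.
Qed.

End Words.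

(** * The pentagon identity and the two forms of R *)

Section Pentagon.
Variables (K : fieldType) (e : expmap K) (hbar : K) (n : nat).
Local Notation q := (e hbar).
Hypothesis q_generic : not_root_of_unity q.
Variable z : 'cV[int]_(n + n).
Local Notation qmono := (qmono K n).
Local Notation factor := (factor K n).
Local Notation laurent := (laurent K z).
Local Notation psi := (@psi K e hbar n z).
Local Notation psis := (@psis K e hbar n z).
Local Notation pos_factor := (@pos_factor K n z).
Implicit Types (A B D : qmono).

(* e^(l + l') up to the scalar factors of the monomials; unlike qmono_mul it   *)
(* is commutative *)
Definition qmono_sym A B : qmono := (A.1 * B.1, A.2 + B.2).

Lemma pos_factor_sym (b : bool) A B :
  pos_factor (b, A) -> pos_factor (b, B) -> pos_factor (b, qmono_sym A B).
Proof. by rewrite /pos_factor /= omegaDr; exact: addr_gt0. Qed.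

Lemma psi_pentagon A B f : pos_factor (true, A) -> pos_factor (true, B) ->
  omega A.2 B.2 = 1 ->
  psi (true, A) (psi (true, B) f) =
  psi (true, B) (psi (true, qmono_sym A B) (psi (true, A) f)).
Proof. by move=> *; apply: series_pentagon => //; apply: expmap_neq0. Qed.

(** The pentagon as a relator: rotations and inverses of this single word give every way of using
    the identity. *)
Lemma psis_pentagon_relator A B f :
  pos_factor (true, A) -> pos_factor (true, B) -> omega A.2 B.2 = 1 ->
  psis [:: (true, A); (true, B); (false, A); (false, qmono_sym A B);
           (false, B)] f = f.
Proof.
move=> A0 B0 AB; rewrite /= psi_pentagon //.
have VK C g : pos_factor (false, C) -> psi (true, C) (psi (false, C) g) = g.
  by move=> C0; apply: (psiK q_generic (a := (false, C))).
by rewrite !VK //; apply: pos_factor_sym.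
Qed.

(** The dilogarithms of the first form of R, and in [R_word'] those of the second form once the
    factors behind P are moved to its left. *)
Definition R_word A B D : seq factor :=
  [:: (false, A); (false, qmono_sym A B); (true, qmono_sym D B); (true, D)].

Definition R_word' A B D : seq factor :=
  [:: (false, B); (false, A); (true, D); (true, B)].

(** In the second form, the pentagons for (A, B), inverted, and for (D, B) produce adjacent
    Psi_q(B)^-1 and Psi_q(B), which cancel. *)
Lemma psis_R_word A B D f : pos_factor (true, A) -> pos_factor (true, B) ->
  pos_factor (true, D) -> omega A.2 B.2 = 1 -> omega D.2 B.2 = 1 ->
  psis (R_word A B D) f = psis (R_word' A B D) f.
Proof.
move=> A0 B0 D0 AB DB; rewrite /= (psi_pentagon _ D0 B0 DB).
have KV C g : pos_factor (true, C) -> psi (false, C) (psi (true, C) g) = g.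
  by move=> C0; apply: (psiK q_generic (a := (true, C))).
have VK C g : pos_factor (false, C) -> psi (true, C) (psi (false, C) g) = g.
  by move=> C0; apply: (psiK q_generic (a := (false, C))).
move: (psi (true, qmono_sym D B) _) => g; set h := LHS.
have -> : g = psi (true, qmono_sym A B) (psi (true, A) h).
  by rewrite /h !VK //; apply: pos_factor_sym.
by rewrite -psi_pentagon // !KV.
Qed.

End Pentagon.

(** * The adjoint action and the R operators *)

Section OmegaBasis.
Variable n : nat.
Implicit Types i j : 'I_n.

Lemma u_l i j : u_ i (lshift n j) 0 = (i == j)%:R.
Proof. by rewrite mxE andbT (inj_eq (@lshift_inj _ _)) eq_sym. Qed.

Lemma u_r i j : u_ i (rshift n j) 0 = 0.
Proof. by rewrite mxE eq_sym eq_lrshift. Qed.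

Lemma w_l i j : w_ i (lshift n j) 0 = 0.
Proof. by rewrite mxE eq_lrshift. Qed.

Lemma w_r i j : w_ i (rshift n j) 0 = (i == j)%:R.
Proof. by rewrite mxE andbT (inj_eq (@rshift_inj _ _)) eq_sym. Qed.

Lemma omega_ux i x : omega (u_ i) x = x (rshift n i) 0.
Proof.
rewrite omegaE (bigD1 i) //= u_l u_r eqxx mul1r mul0r subr0 big1 ?addr0 //.
by move=> j ji; rewrite u_l u_r eq_sym (negbTE ji) !mul0r subrr.
Qed.

Lemma omega_wx i x : omega (w_ i) x = - x (lshift n i) 0.
Proof.
rewrite omegaE (bigD1 i) //= w_l w_r eqxx mul1r mul0r sub0r big1 ?addr0 //.
by move=> j ji; rewrite w_l w_r eq_sym (negbTE ji) !mul0r subrr.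
Qed.

Lemma omega_uu i j : omega (u_ i) (u_ j) = 0.
Proof. by rewrite omega_ux u_r. Qed.

Lemma omega_ww i j : omega (w_ i) (w_ j) = 0.
Proof. by rewrite omega_wx w_l oppr0. Qed.

Lemma omega_uw i j : omega (u_ i) (w_ j) = (i == j)%:R.
Proof. by rewrite omega_ux w_r eq_sym. Qed.

Lemma omega_wu i j : omega (w_ i) (u_ j) = - (i == j)%:R.
Proof. by rewrite omega_wx u_l eq_sym. Qed.

Lemma omegaNl (x y : 'cV[int]_(n + n)) : omega (- x) y = - omega x y.
Proof. by rewrite omegaC omegaNr -omegaC. Qed.

Lemma omegaBl (x x' y : 'cV[int]_(n + n)) :
  omega (x - x') y = omega x y - omega x' y.
Proof. by rewrite omegaDl omegaNl. Qed.

Definition omega_uwE :=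
  (omegaBl, omegaBr, omegaDl, omegaDr, omegaNl, omegaNr, omega_uu, omega_ww,
   omega_uw, omega_wu).

End OmegaBasis.

Section AdjointAction.
Variables (K : fieldType) (e : expmap K) (hbar : K) (n : nat).
Local Notation J := (jacobi n e hbar).
Local Notation JS := (jacobiS n e hbar).
Local Notation qmono := (qmono K n).
Local Notation X := (@qmono_exp K n e).
Local Notation lin := (linear_part e hbar).

(* The homomorphism from the semidirect product with S_n to Jacobi that        *)
(* realizes the permutations as linear maps *)
Definition toJ (g : JS) : J := (g.1 * lin (idx_mx g.2))%g.

Lemma toJM (g h : JS) : toJ (g * h)%g = (toJ g * toJ h)%g.
Proof.
rewrite /toJ /= /permJ idx_mxM linear_partM ?symplectic_idx //.
by rewrite !mulgA mulgKV.
Qed.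

(** [toJ] absorbs the permutation into the matrix, so the permutations have to be compared
    separately. *)
Lemma toJ_inj (g h : JS) : toJ g = toJ h -> g.2 = h.2 -> g = h.
Proof. by case: g h => [x s] [y t] + /= st; rewrite /toJ st /= => /mulIg ->. Qed.

Definition AdJ (g : J) (x : qmono) : qmono :=
  let: (_, a, M) := val g in
  (x.1 * e (2 * omega a (toC (M *m x.2))), M *m x.2).

Lemma AdJM g h x : AdJ (g * h)%g x = AdJ g (AdJ h x).
Proof.
case: g h => [[[b a] M] H] [[[b' a'] M'] H']; have /andP[/= _ sM] := H.
rewrite /AdJ /=.
rewrite -!mulmxA; congr (_, _); rewrite -mulrA -expmapD; congr (_ * e _).
by rewrite omegaDl toCM omega_symplectic // mulrDr addrC.
Qed.

Lemma Ad_toJ (g : JS) x : Ad g x = AdJ (toJ g) x.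
Proof.
case: g => [[[[b a] M] H] s].
rewrite /AdJ /toJ /Ad /= val_linear_part ?symplectic_idx //=.
by rewrite mulmx0 addr0 -mulmxA.
Qed.

Lemma AdM (g h : JS) x : Ad (g * h)%g x = Ad g (Ad h x).
Proof. by rewrite !Ad_toJ toJM AdJM. Qed.

Lemma toJ1 : toJ (1%g : JS) = 1%g.
Proof. by rewrite /toJ mul1g idx_mx1 linear_part1. Qed.

Lemma Ad1 x : Ad (1%g : JS) x = x.
Proof.
rewrite Ad_toJ toJ1 /AdJ /= mul1mx omega0l mulr0 expmap0 mulr1.
by case: x.
Qed.

(** The action is linear on exponents and multiplies the coefficient by a character of the
    exponent. *)
Lemma Ad_sym (g : JS) A B : Ad g (qmono_sym A B) = qmono_sym (Ad g A) (Ad g B).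
Proof.
case: g => [[[[b a] M] H] s]; rewrite /Ad /qmono_sym /=.
rewrite !mulmxDr /toC map_mxD omegaDr mulrDr expmapD.
by congr (_, _); rewrite mulrACA.
Qed.

Definition P_mx (i j k : 'I_n) : 'M[int]_(n + n) :=
  expQ_mx (u_ i - w_ i) (w_ j - w_ k) *m idx_mx (tperm j k).

Lemma omega_P_mx (i j k : 'I_n) : i != j -> i != k ->
  omega (u_ i - w_ i) (w_ j - w_ k) = 0.
Proof. by move=> /negbTE ij /negbTE ik; rewrite !omega_uwE ij ik. Qed.

Lemma symplectic_P_mx (i j k : 'I_n) : i != j -> i != k -> symplectic (P_mx i j k).
Proof.
move=> ij ik; rewrite /P_mx symplecticM ?symplectic_idx //.
by rewrite symplectic_expQ ?omega_P_mx.
Qed.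

Lemma toJ_P_op (lj lk : K) (i j k : 'I_n) : i != j -> i != k ->
  toJ (P_op e hbar lj lk i j k) =
  (lin (P_mx i j k) *
   expL e hbar (((lj - lk) / 2) *: toC (u_ k - w_ i)))%g.
Proof.
move=> ij ik; rewrite /P_op !toJM /toJ /= idx_mx1 linear_part1 !mulg1 mul1g.
by rewrite /P_mx linear_partM ?symplectic_idx // symplectic_expQ ?omega_P_mx.
Qed.

End AdjointAction.

(** * The R operators as words followed by P *)

Section ROperatorWords.
Variables (K : numFieldType) (e : expmap K) (hbar : K) (n : nat).
Local Notation JS := (jacobiS n e hbar).
Local Notation qop := (qop e hbar n).
Local Notation X := (@qmono_exp K n e).

Lemma qmono_sym_exp c c' l l' : qmono_sym (X c l) (X c' l') = X (c + c') (l + l').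
Proof. by rewrite /qmono_sym /qmono_exp expmapD. Qed.

Lemma Ad_P_op lj lk (i j k : 'I_n) c l : i != j -> i != k ->
  Ad (P_op e hbar lj lk i j k) (X c l) =
  X (c + (lj - lk) * (omega (u_ k - w_ i) l)%:~R) (P_mx i j k *m l).
Proof.
move=> ij ik; rewrite Ad_toJ toJ_P_op // AdJM {2}/AdJ /= mul1mx.
rewrite /AdJ val_linear_part ?symplectic_P_mx //= omega0l mulr0 expmap0 mulr1.
rewrite -expmapD omegaZl omega_toC /qmono_exp; congr (e (_ + _), _).
by field.
Qed.

(** Together with [P_mx_ww], this carries the two factors behind P in the second form of R to
    Psi_q(D) and Psi_q(B). *)
Lemma P_mx_uw (i j k : 'I_n) : i != j -> j != k -> i != k ->
  P_mx i j k *m (w_ i - u_ k) = u_ i - u_ j + w_ j - w_ k.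
Proof.
move=> /negbTE ij /negbTE jk /negbTE ik.
rewrite /P_mx -mulmxA mulmxBr idx_mx_w idx_mx_u tpermR tpermD; first last.
- by rewrite eq_sym ik.
- by rewrite eq_sym ij.
rewrite expQ_mxE !omega_uwE (eq_sym k) !eqxx ij jk !(oppr0, subr0, opprK, scale1r).
by apply/matrixP => a b; rewrite !mxE; ring.
Qed.

Lemma P_mx_ww (i j k : 'I_n) : i != j -> j != k -> i != k ->
  P_mx i j k *m (w_ j - w_ k) = w_ k - w_ j.
Proof.
move=> /negbTE ij /negbTE jk /negbTE ik.
rewrite /P_mx -mulmxA mulmxBr !idx_mx_w tpermL tpermR.
rewrite expQ_mxE !omega_uwE ij ik !(oppr0, subr0, scale0r, addr0).
by [].
Qed.

Definition R_A (i k : 'I_n) := X 0 (u_ k - w_ i).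
Definition R_B (lk : K) (j k : 'I_n) := X lk (w_ k - w_ j).
Definition R_D (li lk : K) (i j k : 'I_n) :=
  X (li - lk) (u_ i - u_ j + w_ j - w_ k).

Lemma R_opE li lj lk (i j k : 'I_n) :
  R_op e hbar li lj lk i j k =
  (R_word (R_A i k) (R_B lk j k) (R_D li lk i j k), P_op e hbar lj lk i j k).
Proof.
rewrite /R_op /qop_mul /= !(mul1g, mulg1, Ad1); congr (_, _).
rewrite /R_word !qmono_sym_exp add0r subrK.
have -> : u_ k - w_ i + (w_ k - w_ j) = u_ k - w_ i - w_ j + w_ k.
  by rewrite addrA addrAC.
have -> : u_ i - u_ j + w_ j - w_ k + (w_ k - w_ j) = u_ i - u_ j.
  by rewrite addrA subrK addrK.
by [].
Qed.

Lemma R_op'E li lj lk (i j k : 'I_n) : i != j -> j != k -> i != k ->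
  R_op' e hbar li lj lk i j k =
  (R_word' (R_A i k) (R_B lk j k) (R_D li lk i j k), P_op e hbar lj lk i j k).
Proof.
move=> ij jk ik; rewrite /R_op' /qop_mul /= !(mul1g, mulg1, Ad1) !Ad_P_op //.
rewrite P_mx_uw // P_mx_ww // -(opprB (u_ k)) omegaNr omegaaa oppr0 mulr0 addr0.
have -> : omega (u_ k - w_ i) (w_ j - w_ k) = -1.
  by rewrite !omega_uwE eqxx eq_sym (negbTE jk) !subr0 sub0r.
by rewrite mulrN1 opprB [lj + _]addrC subrK.
Qed.

Lemma qop_mulA (x y w : qop) : qop_mul x (qop_mul y w) = qop_mul (qop_mul x y) w.
Proof.
rewrite /qop_mul /= map_cat catA mulgA -map_comp; congr (_ ++ _, _).
by apply: eq_map => f /=; rewrite AdM.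
Qed.

Lemma qop_mul1 (x : qop) : qop_mul x ([::], 1%g) = x.
Proof. by case: x => fs g; rewrite /qop_mul /= cats0 mulg1. Qed.

End ROperatorWords.

Section QopEq.
Variables (K : numFieldType) (e : expmap K) (hbar : K) (n : nat).
Hypothesis q_generic : not_root_of_unity (e hbar).

(** The expansions do not depend on z; any z positive on both words provides a space of series on
    which to compare them. *)
Lemma qop_eq_psis (z : 'cV[int]_(n + n)) (x y : qop e hbar n) :
  all (pos_factor z) x.1 -> all (pos_factor z) y.1 ->
  (forall f, psis e hbar (z := z) x.1 f = psis e hbar y.1 f) -> x.2 = y.2 -> x === y.
Proof.
move=> x0 y0 xy gxy; split=> // [||l]; first exact: expandable_pos_factor x0.
  exact: expandable_pos_factor y0.
by rewrite (expansionE _ _ _ x0) (expansionE _ _ _ y0) xy.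
Qed.

Lemma R_op_R_op' li lj lk (i j k : 'I_n) : i != j -> j != k -> i != k ->
  R_op e hbar li lj lk i j k === R_op' e hbar li lj lk i j k.
Proof.
move=> ij jk ik; rewrite R_opE R_op'E //.
have [/negbTE ji /negbTE kj] : j != i /\ k != j by rewrite eq_sym ij eq_sym jk.
have /negbTE ki : k != i by rewrite eq_sym.
move: ij jk ik => /negbTE ij /negbTE jk /negbTE ik.
set A := R_A _ _ _; set B := R_B _ _ _ _; set D := R_D _ _ _ _ _ _.
have AB : omega A.2 B.2 = 1.
  by rewrite /A /B /= !omega_uwE !(eqxx, ij, jk, ik, ji, kj, ki); lia.
have DB : omega D.2 B.2 = 1.
  by rewrite /D /B /= !omega_uwE !(eqxx, ij, jk, ik, ji, kj, ki); lia.
(* Chosen to give A, B and D degree 1 each. *)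
pose z : 'cV[int]_(n + n) := u_ k - w_ k - w_ i - w_ i.
have zA b : pos_factor z (b, A).
  by rewrite /pos_factor /z /A /= !omega_uwE !(eqxx, ij, jk, ik, ji, kj, ki); lia.
have zB b : pos_factor z (b, B).
  by rewrite /pos_factor /z /B /= !omega_uwE !(eqxx, ij, jk, ik, ji, kj, ki); lia.
have zD b : pos_factor z (b, D).
  by rewrite /pos_factor /z /D /= !omega_uwE !(eqxx, ij, jk, ik, ji, kj, ki); lia.
apply: (@qop_eq_psis z); last by [].
- by rewrite [all _ _]/= !pos_factor_sym ?zA ?zB ?zD.
- by rewrite [all _ _]/= !zA !zB !zD.
- by move=> f; apply: psis_R_word.
Qed.

End QopEq.

(** * Codes of monomials *)

(* The monomials e^(sum_i (a_i lambda_i + b_i u_i + c_i w_i)) that occur for   *)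
(* n = 6 are coded by the lists of the 18 integers a_i, b_i, c_i, to have the  *)
(* words of the tetrahedron equation compared by computation. The indices run  *)
(* from 0 to 5.                                                                *)
Definition code := seq int.

Section Codes.
Implicit Types s t : code.

Definition code_of (f : nat -> int) : code := mkseq f 18.

Definition code_add s t := code_of (fun m => s`_m + t`_m).
Definition code_scale c s := code_of (fun m => c * s`_m).
Definition code_sub s t := code_of (fun m => s`_m - t`_m).
Definition code_lambda (k : nat) := code_of (fun m => (m == k)%:Z).
Definition code_u k := code_lambda (6 + k).
Definition code_w k := code_lambda (12 + k).

Definition code_omega s t : int :=
  foldr (fun m x => s`_(6 + m) * t`_(12 + m) - s`_(12 + m) * t`_(6 + m) + x)
    0 (iota 0 6).

Definition swap_nat (j k m : nat) := if m == j then k else if m == k then j else m.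

(** The swap acts within the block of the u and the block of the w; the first six entries stay,
    since the transposition does not permute the parameters. *)
Definition code_perm j k s := code_of (fun m =>
  s`_(if (m < 6)%N then m else m %/ 6 * 6 + swap_nat j k (m %% 6))%N).

(** The affine map of [Ad_P_op] on codes: the permutation, then [expQ_mxE] for f = u_i - w_i and g =
    w_j - w_k, then the shift of the parameters. *)
Definition code_P i j k s :=
  let t := code_perm j k s in
  let f := code_sub (code_u i) (code_w i) in
  let g := code_sub (code_w j) (code_w k) in
  code_add (code_add t (code_add (code_scale (code_omega f t) g)
                                 (code_scale (code_omega g t) f)))
    (code_scale (code_omega (code_sub (code_u k) (code_w i)) s)
                (code_sub (code_lambda j) (code_lambda k))).

Lemma nth_code f m : (m < 18)%N -> (code_of f)`_m = f m.
Proof. exact: nth_mkseq. Qed.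

End Codes.

Section Interpretation.
Implicit Types s t : code.
Variables (K : numFieldType) (e : expmap K) (lambda : 'I_6 -> K).
Local Notation lform := 'cV[int]_(6 + 6).
Local Notation X := (@qmono_exp K 6 e).

Definition par s : K := \sum_(m < 6) (s`_m)%:~R * lambda m.
Definition vec s : lform :=
  \sum_(m < 6) (s`_(6 + m) *: u_ m + s`_(12 + m) *: w_ m).
Definition mono s : qmono K 6 := X (par s) (vec s).

Lemma ltn6 a (m : 'I_6) : (a <= 12)%N -> (a + m < 18)%N.
Proof. by move: (ltn_ord m); lia. Qed.

Lemma par_add s t : par (code_add s t) = par s + par t.
Proof.
rewrite /par -big_split; apply: eq_bigr => m _ /=.
by rewrite nth_code ?(ltn6 (a := 0)) // intrD mulrDl.
Qed.

Lemma par_sub s t : par (code_sub s t) = par s - par t.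
Proof.
rewrite /par -sumrB; apply: eq_bigr => m _ /=.
by rewrite nth_code ?(ltn6 (a := 0)) // intrB mulrBl.
Qed.

Lemma par_scale c s : par (code_scale c s) = c%:~R * par s.
Proof.
rewrite /par mulr_sumr; apply: eq_bigr => m _ /=.
by rewrite nth_code ?(ltn6 (a := 0)) // intrM mulrA.
Qed.

Lemma vec_add s t : vec (code_add s t) = vec s + vec t.
Proof.
rewrite /vec -big_split; apply: eq_bigr => m _.
by rewrite !nth_code ?ltn6 // !scalerDl addrACA.
Qed.

Lemma vec_sub s t : vec (code_sub s t) = vec s - vec t.
Proof.
rewrite /vec -sumrB; apply: eq_bigr => m _.
by rewrite !nth_code ?ltn6 // !scalerBl opprD addrACA.
Qed.

Lemma vec_scale c s : vec (code_scale c s) = c *: vec s.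
Proof.
rewrite /vec scaler_sumr; apply: eq_bigr => m _.
by rewrite !nth_code ?ltn6 // scalerDr !scalerA.
Qed.

Lemma ord_neq_inord (m : 'I_6) k : m != inord k -> (m == k :> nat) = false.
Proof. by apply: contraNF => /eqP <-; rewrite inord_val. Qed.

Lemma inord_neq (k m : nat) : (k < 6)%N -> (m < 6)%N -> k != m ->
  inord k != inord m :> 'I_6.
Proof.
by move=> k6 m6; apply: contraNneq => /(congr1 val) /=; rewrite !inordK // => ->.
Qed.

Lemma par_lam k : (k < 6)%N -> par (code_lambda k) = lambda (inord k).
Proof.
move=> k6; rewrite /par (bigD1 (inord k)) //= nth_code ?(ltn6 (a := 0)) //.
rewrite inordK // eqxx mul1r big1 ?addr0 // => m mk.
rewrite nth_code ?(ltn6 (a := 0)) // ord_neq_inord //.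
by rewrite mul0r.
Qed.

Lemma par_ge6 k : par (code_lambda (6 + k)) = 0.
Proof.
rewrite /par big1 // => m _; rewrite nth_code ?(ltn6 (a := 0)) //.
by rewrite ltn_eqF ?mul0r // ltn_addr.
Qed.

Lemma par_u k : par (code_u k) = 0. Proof. exact: par_ge6. Qed.

Lemma par_w k : par (code_w k) = 0. Proof. exact: (par_ge6 (6 + k)). Qed.

Lemma vec_lam k : (k < 6)%N -> vec (code_lambda k) = 0.
Proof.
move=> k6; rewrite /vec big1 // => m _; rewrite !nth_code ?ltn6 //.
have [-> ->] : (6 + m == k)%N = false /\ (12 + m == k)%N = false by lia.
by rewrite !scale0r addr0.
Qed.

Lemma vec_u k : (k < 6)%N -> vec (code_u k) = u_ (inord k).
Proof.
move=> k6; rewrite /vec (bigD1 (inord k)) // !nth_code ?ltn6 //.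
have ne (m : 'I_6) : (12 + m == 6 + k)%N = false by lia.
rewrite big1 => [|m mk]; last first.
  by rewrite !nth_code ?ltn6 // ne eqn_add2l ord_neq_inord // !scale0r addr0.
by rewrite ne inordK // eqxx scale1r scale0r addr0 [LHS]addr0.
Qed.

Lemma vec_w k : (k < 6)%N -> vec (code_w k) = w_ (inord k).
Proof.
move=> k6; rewrite /vec (bigD1 (inord k)) // !nth_code ?ltn6 //.
have ne (m : 'I_6) : (6 + m == 12 + k)%N = false by have := ltn_ord m; lia.
rewrite big1 => [|m mk]; last first.
  by rewrite !nth_code ?ltn6 // ne eqn_add2l ord_neq_inord // !scale0r addr0.
by rewrite ne inordK // eqxx scale1r scale0r add0r [LHS]addr0.
Qed.

Definition vecE := (vec_add, vec_sub, vec_scale).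
Definition parE := (par_add, par_sub, par_scale).

Lemma vec_entry s x : vec s x 0 =
  \sum_(m < 6) (s`_(6 + m) * u_ m x 0 + s`_(12 + m) * w_ m x 0).
Proof. by rewrite summxE; apply: eq_bigr => m _; rewrite mxE !mxE. Qed.

Lemma vec_l s (m : 'I_6) : vec s (lshift 6 m) 0 = s`_(6 + m).
Proof.
rewrite vec_entry (bigD1 m) // u_l w_l eqxx mulr1 mulr0 big1 => [|i im].
  by rewrite addr0 [LHS]addr0.
by rewrite u_l w_l (negbTE im) !mulr0 addr0.
Qed.

Lemma vec_r s (m : 'I_6) : vec s (rshift 6 m) 0 = s`_(12 + m).
Proof.
rewrite vec_entry (bigD1 m) // u_r w_r eqxx mulr1 mulr0 big1 => [|i im].
  by rewrite add0r [LHS]addr0.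
by rewrite u_r w_r (negbTE im) !mulr0 addr0.
Qed.

Lemma omega_vec s t : omega (vec s) (vec t) = code_omega s t.
Proof.
rewrite omegaE; under eq_bigr do rewrite !vec_l !vec_r.
by rewrite -(big_mkord xpredT (fun m =>
  s`_(6 + m) * t`_(12 + m) - s`_(12 + m) * t`_(6 + m))) unlock.
Qed.

Lemma mono_add s t : mono (code_add s t) = qmono_sym (mono s) (mono t).
Proof. by rewrite qmono_sym_exp /mono vec_add par_add. Qed.

Lemma nat_of_tperm (j k : nat) (m : 'I_6) : (j < 6)%N -> (k < 6)%N ->
  tperm (inord j) (inord k) m = swap_nat j k m :> nat.
Proof.
move=> j6 k6; rewrite /swap_nat; case: tpermP => [->|->|].
- by rewrite !inordK // eqxx.
- by rewrite !inordK // eqxx; case: eqP.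
by move=> /eqP mj /eqP mk; rewrite !ord_neq_inord.
Qed.

Lemma par_perm j k s : par (code_perm j k s) = par s.
Proof.
by apply: eq_bigr => m _; rewrite nth_code ?(ltn6 (a := 0)) // ltn_ord.
Qed.

Lemma vec_perm j k s : (j < 6)%N -> (k < 6)%N ->
  vec (code_perm j k s) = idx_mx (tperm (inord j) (inord k)) *m vec s.
Proof.
move=> j6 k6; pose p := tperm (inord j) (inord k) : 'S_6.
rewrite /vec mulmx_sumr [LHS](reindex_inj (@perm_inj _ p)).
apply: eq_bigr => m _; rewrite mulmxDr -!scalemxAr idx_mx_u idx_mx_w.
rewrite !nth_code ?ltn6 //.
have pm6 := ltn_ord (p m).
have pK : swap_nat j k (p m) = m :> nat by rewrite -nat_of_tperm // tpermK.
have -> : (6 + p m < 6)%N = false by lia.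
have -> : (12 + p m < 6)%N = false by lia.
have [-> ->] : ((6 + p m) %% 6 = p m /\ (12 + p m) %% 6 = p m)%N by lia.
have [-> ->] : ((6 + p m) %/ 6 * 6 = 6 /\ (12 + p m) %/ 6 * 6 = 12)%N by lia.
by rewrite pK.
Qed.

Lemma omega_code s t : omega (mono s).2 (mono t).2 = code_omega s t.
Proof. exact: omega_vec. Qed.

Lemma Ad_P_code (hbar : K) i j k s : (i < 6)%N -> (j < 6)%N -> (k < 6)%N ->
  i != j -> i != k ->
  Ad (P_op e hbar (lambda (inord j)) (lambda (inord k))
        (inord i) (inord j) (inord k)) (mono s) = mono (code_P i j k s).
Proof.
move=> i6 j6 k6 ij ik.
rewrite Ad_P_op ?inord_neq // /code_P /mono !parE !vecE par_perm vec_perm //.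
rewrite !par_w !par_u !par_lam // !vec_w // !vec_u // !vec_lam //.
rewrite !subr0 !mulr0 !scaler0 !addr0.
rewrite -!omega_vec !vec_sub vec_perm // !vec_w // !vec_u //.
congr X; first by rewrite mulrC.
by rewrite /P_mx -mulmxA expQ_mxE addrA.
Qed.

End Interpretation.

(** * Certified derivations between words *)

Definition letter := (bool * code)%type.
Definition word := seq letter.

Section Derivations.
Implicit Types (a b : letter) (v w : word).

(* A solution of the linear inequalities expressing that all the factors of    *)
(* both forms of the tetrahedron equation have positive degree                 *)
Definition grading : code :=
  nseq 6 0 ++ [:: 0; -3; -1; 1; 0; 1] ++ [:: -4; 1; 3; -1; 1; -2].

Definition pos_letter a := 0 < code_omega grading a.2.

Definition inv_letter a : letter := (~~ a.1, a.2).

Definition inv_word w := rev (map inv_letter w).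

(** Brings the first occurrence of a to the front by commutations, if it commutes with all the
    letters before it, and removes it. *)
Fixpoint pull a w : option word :=
  if w is b :: w' then
    if a == b then Some w'
    else if code_omega a.2 b.2 == 0 then omap (cons b) (pull a w') else None
  else None.

Fixpoint shuffle v w : bool :=
  if v is a :: v' then
    if pull a w is Some w' then shuffle v' w' else false
  else nilp w.

(** Cancels inverse letters that commutations make adjacent. *)
Fixpoint free_reduce w : word :=
  if w is a :: w' then
    let v := free_reduce w' in
    if pull (inv_letter a) v is Some v' then v' else a :: v
  else [::].

Definition pentagon_relator w : bool :=
  if w is [:: (true, s); (true, t); a; (false, r); b] then
    [&& a == (false, s) :> letter, b == (false, t) :> letter, r == code_add s t
      & code_omega s t == 1]
  else false.

(** v and w are complementary arcs of the pentagon: v w^-1 or w v^-1 is a relator up to rotation. *)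
Definition pentagon_move v w : bool :=
  has (fun m => pentagon_relator (rot m (v ++ inv_word w))
             || pentagon_relator (rot m (w ++ inv_word v))) (iota 0 5).

(* A move (x, u, v, y) replaces x u y by x v y. *)
Definition move := (word * word * word * word)%type.

(** Cancellations and commutations are left implicit: before each move the current word is reduced,
    then reordered to expose u. *)
Fixpoint derives v (ms : seq move) w : bool :=
  if ms is (x, u, u', y) :: ms' then
    [&& shuffle (x ++ u ++ y) (free_reduce v), all pos_letter u', pentagon_move u u'
      & derives (x ++ u' ++ y) ms' w]
  else shuffle w (free_reduce v).

End Derivations.

Section Soundness.
Implicit Types (a b : letter) (v w : word).
Variables (K : numFieldType) (e : expmap K) (hbar : K) (lambda : 'I_6 -> K).
Hypothesis q_generic : not_root_of_unity (e hbar).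
Local Notation z := (vec grading).
Local Notation psi := (@psi K e hbar 6 z).
Local Notation psis := (@psis K e hbar 6 z).
Local Notation mono := (mono e lambda).

Definition factor_of a : factor K 6 := (a.1, mono a.2).
Local Notation factors_of := (map factor_of).

Lemma pos_factor_letter a : pos_factor z (factor_of a) = pos_letter a.
Proof. by rewrite /pos_factor omega_vec. Qed.

Lemma pos_factor_letters w : all (pos_factor z) (factors_of w) = all pos_letter w.
Proof. by rewrite all_map; apply: eq_all => a; exact: pos_factor_letter. Qed.

Lemma factors_of_inv w : factors_of (inv_word w) = inv_factors (factors_of w).
Proof. by rewrite /inv_word /inv_factors map_rev -!map_comp. Qed.

Lemma pull_sound a w w' : pull a w = Some w' -> all pos_letter w ->
  [/\ pos_letter a, all pos_letter w' &
   forall f, psis (factors_of w) f = psis (factors_of (a :: w')) f].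
Proof.
elim: w w' => //= b w IHw w'; case: eqP => [<- [<-] /andP[]//|_].
case: eqP => // ab; case: (pull a w) IHw => //= w'' /(_ _ erefl) IHw [<-].
move=> /andP[b0 /IHw[a0 w0 fE]]; split; rewrite /= ?b0 // => f.
by rewrite fE /= psi_comm ?pos_factor_letter // omegaC omega_code ab oppr0.
Qed.

Lemma shuffle_sound v w : shuffle v w -> all pos_letter w ->
  all pos_letter v /\
  forall f, psis (factors_of v) f = psis (factors_of w) f.
Proof.
elim: v w => [|a v IHv] w /=; first by case: w.
case aw: (pull a w) => [w'|] // vw' w0.
have [a0 w'0 wE] := pull_sound aw w0; have [v0 vE] := IHv _ vw' w'0.
by split=> [|f]; rewrite ?a0 // wE /= vE.
Qed.

Lemma free_reduce_sound w : all pos_letter w ->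
  all pos_letter (free_reduce w) /\
  forall f, psis (factors_of (free_reduce w)) f = psis (factors_of w) f.
Proof.
elim: w => //= a w IHw /andP[a0 /IHw[v0 vE]].
case av: (pull _ _) => [v'|]; last by rewrite /= a0; split=> // f; rewrite vE.
have [_ v'0 v'E] := pull_sound av v0; split=> // f.
rewrite -vE v'E; have a'0 : pos_factor z (factor_of (inv_letter a)).
  by rewrite pos_factor_letter.
by have := psiK q_generic a'0 (psis (factors_of v') f); case: (a) => [[] s] ->.
Qed.

Lemma pentagon_relator_sound w f : pentagon_relator w -> all pos_letter w ->
  psis (factors_of w) f = f.
Proof.
case: w => [//|[[] s] [//|[[] t] [//|a [//|[[] r] [//|b [|//]]]]]] //=.
case/and4P => /eqP-> /eqP-> /eqP-> /eqP st /and5P[s0 t0 _ _ _].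
have := @psis_pentagon_relator _ e hbar 6 q_generic z (mono s) (mono t) f.
by rewrite -mono_add omega_code !(pos_factor_letter (true, _)); apply.
Qed.

Lemma pentagon_move_sound v w f : pentagon_move v w ->
  all pos_letter v -> all pos_letter w ->
  psis (factors_of v) f = psis (factors_of w) f.
Proof.
(* [pentagon_move] is symmetric in the two words. *)
move=> vw v0 w0; wlog: v w vw v0 w0 / has (fun m =>
    pentagon_relator (rot m (v ++ inv_word w))) (iota 0 5).
  move=> VW; move: (vw); rewrite /pentagon_move has_predU => /orP[]; first exact: VW.
  by move=> wv; apply/esym/VW => //; rewrite /pentagon_move has_predU wv.
case/hasP => m _ rm.
have vw0 : all pos_letter (v ++ inv_word w).
  rewrite all_cat v0 -pos_factor_letters factors_of_inv pos_factor_inv_factors.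
  by rewrite pos_factor_letters.
have vw1 g : psis (factors_of (v ++ inv_word w)) g = g.
  rewrite -[v ++ _](rotK m) /rotr map_rot; apply: psis_rot => // [|h].
    by rewrite pos_factor_letters (eq_all_r (mem_rot m _)).
  by rewrite pentagon_relator_sound // (eq_all_r (mem_rot m _)).
rewrite -[in RHS](vw1 (psis (factors_of w) f)) map_cat psis_cat factors_of_inv.
by rewrite psisK // pos_factor_letters.
Qed.

(** Positivity of the initial word suffices: reduction and reordering add no letters, and [derives]
    checks those that a move brings in. *)
Lemma derives_sound v ms w f : derives v ms w -> all pos_letter v ->
  psis (factors_of v) f = psis (factors_of w) f.
Proof.
elim: ms v => [|[[[x u] u'] y] ms IHms] v /= + v0;
  have [rv0 <-] := free_reduce_sound v0.
  by move=> wv; have [_ ->] := shuffle_sound wv rv0.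
case/and4P => xuyv u'0 uu' msw; have [] := shuffle_sound xuyv rv0.
rewrite !all_cat => /and3P[x0 u0 y0] <-.
rewrite -(IHms (x ++ u' ++ y)) ?all_cat ?x0 ?u'0 //.
by rewrite !map_cat !psis_cat (pentagon_move_sound _ uu').
Qed.

End Soundness.

(** * The words of the tetrahedron equation and the chain of pentagons *)

Definition code_A i k := code_sub (code_u k) (code_w i).
Definition code_B j k := code_add (code_lambda k) (code_sub (code_w k) (code_w j)).
Definition code_D i j k := code_add (code_sub (code_lambda i) (code_lambda k))
  (code_add (code_sub (code_u i) (code_u j)) (code_sub (code_w j) (code_w k))).

(* The triples of A, B and D of which the words R_word' form the product of    *)
(* the R operators with the indices of the list *)
Fixpoint tetra_codes (l : seq (nat * nat * nat)) : seq (code * code * code) :=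
  if l is (i, j, k) :: l' then
    (code_A i k, code_B j k, code_D i j k) ::
    [seq let: (A, B, D) := x in (code_P i j k A, code_P i j k B, code_P i j k D)
    | x <- tetra_codes l']
  else [::].

Definition R_letters (x : code * code * code) : word :=
  let: (A, B, D) := x in [:: (false, B); (false, A); (true, D); (true, B)].

Definition tetra_word l := flatten [seq R_letters x | x <- tetra_codes l].

Definition tetra_lhs := [:: (3, 4, 5); (1, 2, 5); (0, 2, 4); (0, 1, 3)]%N.
Definition tetra_rhs := rev tetra_lhs.

(* Found by computer search; it relies on the coincidences c = a A2 D1 and     *)
(* d = A2 D1 b between the exponents.                                          *)
Definition tetra_moves : seq move :=
  let E s : letter := (true, s) in
  let V s : letter := (false, s) in
  let A1 := code_A 3 5 in let a := code_B 4 5 in let D1 := code_D 3 4 5 in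
  let A4 := code_A 0 3 in let c := code_B 1 3 in let D4 := code_D 0 1 3 in
  let b := code_B 2 4 in
  let A2 := code_P 3 4 5 (code_A 1 5) in
  let D2 := code_P 3 4 5 (code_D 1 2 5) in
  let d := code_sub (code_add c b) a in
  let A1A4 := code_add A1 A4 in let A2A4 := code_add A2 A4 in
  let aA2 := code_add a A2 in let aA2A4 := code_add aA2 A4 in
  let D1D4 := code_add D1 D4 in let D2D4 := code_add D2 D4 in
  let D1b := code_add D1 b in let D1bD4 := code_add D1b D4 in
  [::
   ([:: V a; V A1; E D1; V b],
    [:: E a; V A2], [:: V aA2; V A2; E a],
    [:: V d; V a; V A1A4; V A4; E D2; E b; E D1D4; E a; E D4; E d]);
   ([:: V a; V A1; E D1; V b; V aA2],
    [:: V A2; V d], [:: V D1b; V A2; E D1b],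
    [:: V A1A4; V A4; E D2; E b; E D1D4; E a; E D4; E d]);
   ([:: V a],
    [:: E D1; V b], [:: V b; E D1; E D1b],
    [:: V A1; V D1b; V aA2; V A1A4; V A2; V A4; E D2; E D1b; E b; E D1D4; E a;
        E D4; E d]);
   ([:: V b; V a; V A1; E D1; V aA2; V A2; E D2; E D1b],
    [:: E b; E D1D4], [:: E D1D4; E D1bD4; E b],
    [:: V A1A4; V A4; E a; E D4; E d]);
   ([:: V b; V a; V A1; E D1; V aA2; V A2; E D2; E D1D4],
    [:: E D1b; E D1bD4], [:: E D4; E D1b; V D4],
    [:: V A1A4; V A4; E a; E b; E D4; E d]);
   ([:: V b; V a; E D1; V aA2],
    [:: V A1; V A1A4], [:: V A4; V A1; E A4],
    [:: V A2; V A4; E D2; E D1D4; E D4; E D1b; E a; E b; E d]);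
   ([:: V b; V a; E D1; V aA2; V A4; V A1],
    [:: E A4; V A2], [:: V A2A4; V A2; E A4],
    [:: E D2; E D1D4; V A4; E D4; E D1b; E a; E b; E d]);
   ([:: V b; V a],
    [:: E D1; V aA2], [:: V c; V aA2; E D1],
    [:: V A4; V A2A4; V A1; V A2; E D2; E D1D4; E D4; E D1b; E a; E b; E d]);
   ([:: V c; V b; V a; V aA2; V A4; V A2A4; V A1; E D1; E D2; E D1D4; E D4],
    [:: V A2; E D1b], [:: E D1b; V A2; V d],
    [:: E a; E b; E d]);
   ([:: V c; V b; V a],
    [:: V aA2; V A4], [:: V A4; V aA2A4; V aA2],
    [:: V A2A4; V A1; E D1; E D2; E D1D4; E D4; E D1b; V A2; E a; E b]);
   ([:: V c; V A4; V b],
    [:: V a; V aA2A4], [:: V A2A4; V a; E A2A4],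
    [:: V aA2; V A2A4; V A1; E D1; E D2; E D1D4; E D4; E D1b; V A2; E a; E b]);
   ([:: V c; V A4; V b; V A2A4; V a; V aA2],
    [:: E D1; E D1D4], [:: E D4; E D1; V D4],
    [:: V A1; E D2; E D4; E D1b; V A2; E a; E b]);
   ([:: V c; V A4; V b; V A2A4; V a; V aA2; E D4; E D1],
    [:: V D4; E D2], [:: E D2D4; E D2; V D4],
    [:: V A1; E D4; E D1b; V A2; E a; E b]);
   ([:: V c; V A4; V b; V A2A4; V a; V aA2; V A1; E D4; E D1; E D2D4; E D1b],
    [:: V A2; E a], [:: E aA2; E a; V A2],
    [:: E D2; E b]);
   ([:: V c; V A4; V b; V A2A4; V a; E D4],
    [:: V aA2; E D1], [:: E c; E D1; V aA2],
    [:: V A1; E D2D4; E D2; E aA2; E D1b; E a; V A2; E b]);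
   ([:: V c; V A4; V b; V A2A4; V a; E D4; E c; E D2D4],
    [:: E D1; E D1b], [:: E b; E D1; V b],
    [:: V A1; E D2; E a; V A2; E b])].

Lemma tetra_derives :
  derives (tetra_word tetra_lhs) tetra_moves (tetra_word tetra_rhs).
Proof. by vm_compute. Qed.

Lemma tetra_word_pos : all pos_letter (tetra_word tetra_lhs ++ tetra_word tetra_rhs).
Proof. by vm_compute. Qed.

(** * The tetrahedron equation *)

Definition distinct_indices (t : nat * nat * nat) : bool :=
  let: (i, j, k) := t in [&& i < 6, j < 6, k < 6, i != j, j != k & i != k]%N.

(** The exponentials of linear forms after they pass to the left of all linear parts. The one in
    P_ijk stands to the right of its own linear part, so [code_P] applies to it too; an entry (j, k,
    s) has the coefficient (lambda_j - lambda_k) / 2. *)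
Fixpoint tetra_exps (l : seq (nat * nat * nat)) : seq (nat * nat * code) :=
  if l is (i, j, k) :: l' then
    (j, k, code_P i j k (code_A i k)) ::
    [seq (x.1, code_P i j k x.2) | x <- tetra_exps l']
  else [::].

Definition P_code_prod (l : seq (nat * nat * nat)) (s : code) : code :=
  foldr (fun t => let: (i, j, k) := t in code_P i j k) s l.

(** * Equality of the monomial parts *)

Section Products.
Variables (K : numFieldType) (e : expmap K) (hbar : K) (lambda : 'I_6 -> K).
Local Notation JS := (jacobiS 6 e hbar).
Local Notation lin := (linear_part e hbar).
Local Notation expL := (expL e hbar).
Local Notation mono := (mono e lambda).
Local Notation ind := (nat * nat * nat)%type.
Local Notation o i := (inord i : 'I_6).

Definition P_of (t : ind) : JS :=
  let: (i, j, k) := t in P_op e hbar (lambda (o j)) (lambda (o k)) (o i) (o j) (o k).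

Definition P_mx_of (t : ind) := let: (i, j, k) := t in P_mx (o i) (o j) (o k).

Definition P_mx_prod (l : seq ind) := foldr (fun t M => P_mx_of t *m M) 1%:M l.

Definition P_prod (l : seq ind) : JS := foldr (fun t g => P_of t * g)%g 1%g l.

Definition expL_prod (xs : seq (nat * nat * code)) :=
  foldr (fun x g => expL (((lambda (o x.1.1) - lambda (o x.1.2)) / 2) *:
                          toC (vec x.2)) * g)%g 1%g xs.

Lemma vec_P i j k s : distinct_indices (i, j, k) ->
  vec (code_P i j k s) = P_mx (o i) (o j) (o k) *m vec s.
Proof.
case/and5P => i6 j6 k6 ij /andP[jk ik].
have := Ad_P_code e lambda hbar s i6 j6 k6 ij ik.
by rewrite Ad_P_op ?inord_neq // => -[_ <-].
Qed.

Lemma symplectic_P_mx_of t : distinct_indices t -> symplectic (P_mx_of t).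
Proof.
case: t => [[i j] k] /and5P[i6 j6 k6 ij /andP[jk ik]].
by rewrite symplectic_P_mx ?inord_neq.
Qed.

Lemma symplectic_P_mx_prod l : all distinct_indices l -> symplectic (P_mx_prod l).
Proof.
elim: l => [_|t l IHl /andP[t0 l0]]; first exact: symplectic1.
by rewrite symplecticM ?symplectic_P_mx_of ?IHl.
Qed.

Lemma lin_expL_prod M (f : code -> code) xs : symplectic M ->
  (forall s, vec (f s) = M *m vec s) ->
  (lin M * expL_prod xs = expL_prod [seq (x.1, f x.2) | x <- xs] * lin M)%g.
Proof.
move=> sM fM; elim: xs => [|x xs IHxs] /=; first by rewrite mulg1 mul1g.
rewrite mulgA fM toCM scalemxAr -(linear_part_expL _ _ _ sM) -(mulgA _ _ (lin M)).
by rewrite -IHxs !mulgA mulgKV.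
Qed.

Lemma toJ_P_prod l : all distinct_indices l ->
  toJ (P_prod l) = (expL_prod (tetra_exps l) * lin (P_mx_prod l))%g.
Proof.
elim: l => [_|[[i j] k] l IHl /andP[t0 l0]].
  by rewrite toJ1 mul1g linear_part1.
have sP := symplectic_P_mx_of t0.
rewrite [P_mx_prod _]/= linear_partM ?symplectic_P_mx_prod // /=.
rewrite toJM IHl // [RHS]mulgA -[(expL _ * _ * _)%g]mulgA.
rewrite -(lin_expL_prod _ sP (fun s => vec_P s t0)).
rewrite vec_P // /code_A.
have /and5P[i6 j6 k6 ij /andP[jk ik]] := t0.
rewrite toJ_P_op ?inord_neq // vec_sub vec_u // vec_w // toCM scalemxAr.
by rewrite -linear_part_expL // !mulgA mulgKV.
Qed.

(** [code_P] also records parameters, which the linear form ignores. *)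
Lemma eq_vec s t : drop 6 s = drop 6 t -> vec s = vec t.
Proof.
by move=> st; apply: eq_bigr => m _; rewrite -[12%N]/(6 + 6)%N -addnA -!nth_drop st.
Qed.

Lemma eq_expL_prod xs ys :
  [seq (x.1, drop 6 x.2) | x <- xs] = [seq (x.1, drop 6 x.2) | x <- ys] ->
  expL_prod xs = expL_prod ys.
Proof.
elim: xs ys => [|[a s] xs IHxs] [|[b t] ys] //= [-> /eq_vec st xys].
by rewrite st (IHxs _ xys).
Qed.

(** Both the sums of the exponents and the scalar phases from the Baker-Campbell-Hausdorff formula
    agree. *)
Lemma expL_tetra (p1 p2 p4 : 'cV[int]_(6 + 6)) (x1 x3 x4 : K) :
  omega p1 p2 = 1 -> omega p1 p4 = -1 -> omega p2 p4 = 1 ->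
  (expL (x1 *: toC p1) * (expL ((x1 + x3) *: toC p2) *
    (expL (x3 *: toC (p1 + p4)%R) * expL (x4 *: toC p4))) =
   expL (x4 *: toC p4) * (expL (x3 *: toC (p2 + p4)%R) *
    (expL ((x1 + x3) *: toC p1) * expL (x1 *: toC p2))))%g.
Proof.
move=> p12 p14 p24; have p21 : omega p2 p1 = -1 by rewrite omegaC p12.
have p41 : omega p4 p1 = 1 by rewrite omegaC p14 opprK.
have p42 : omega p4 p2 = -1 by rewrite omegaC p24.
apply: val_inj => /=; rewrite !toC1 !mul1mx !mul1r.
congr (_, _, _); last first.
  rewrite /toC !map_mxD !scalerDr !scalerDl; apply/matrixP => a b.
  by rewrite !mxE; ring.
rewrite -!expmapD -!mulrDl; congr (e (_ / hbar)).
rewrite /toC !map_mxD -!/(toC _) !(omegaDl, omegaDr, omegaZl, omegaZr).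
rewrite !omega_toC !omegaaa p12 p14 p24 p21 p41 p42 !mulrNz !mulr1z; ring.
Qed.

Lemma expL_prod_tetra :
  expL_prod (tetra_exps tetra_lhs) = expL_prod (tetra_exps tetra_rhs).
Proof.
(* The image of u_k - w_i under P_ijk. In [p2] the last index is 4 instead of 5, through the
   transposition in the factor with indices 3, 4, 5. *)
pose p i j k :=
  code_sub (code_sub (code_u j) (code_u i)) (code_sub (code_w j) (code_w k)).
pose p1 := p 3 4 5; pose p2 := p 1 2 4; pose p4 := p 0 1 3.
rewrite (@eq_expL_prod (tetra_exps tetra_lhs) [:: (4, 5, p1); (2, 5, p2);
  (2, 4, code_add p1 p4); (1, 3, p4)]%N); last by vm_compute.
rewrite (@eq_expL_prod (tetra_exps tetra_rhs) [:: (1, 3, p4);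
  (2, 4, code_add p2 p4); (2, 5, p1); (4, 5, p2)]%N); last by vm_compute.
have consE j k s xs : expL_prod ((j, k, s) :: xs) =
    (expL (((lambda (o j) - lambda (o k)) / 2) *: toC (vec s)) * expL_prod xs)%g.
  by [].
rewrite !consE !mulg1 !vec_add.
have -> : (lambda (o 2) - lambda (o 5)) / 2 = (lambda (o 4) - lambda (o 5)) / 2 +
    (lambda (o 2) - lambda (o 4)) / 2 by field.
by apply: expL_tetra; rewrite omega_vec; vm_compute.
Qed.

Lemma P_mx_prodE l s : all distinct_indices l ->
  P_mx_prod l *m vec s = vec (P_code_prod l s).
Proof.
elim: l => [|[[i j] k] l IHl] /=; first by rewrite mul1mx.
by move=> /andP[t0 l0]; rewrite -mulmxA IHl // vec_P.
Qed.

Lemma mx_uwP n (A B : 'M[int]_(n + n)) :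
  (forall i, A *m u_ i = B *m u_ i) -> (forall i, A *m w_ i = B *m w_ i) -> A = B.
Proof.
move=> ABu ABw; apply/matrixP => i j.
suff /colP/(_ i) : col j A = col j B by rewrite !mxE.
by rewrite !colE; case: (split_ordP j) => m ->; [exact: ABu|exact: ABw].
Qed.

Lemma eq_P_mx_prod l l' : all distinct_indices l -> all distinct_indices l' ->
  all (fun m => (drop 6 (P_code_prod l (code_u m)) ==
                 drop 6 (P_code_prod l' (code_u m))) &&
                (drop 6 (P_code_prod l (code_w m)) ==
                 drop 6 (P_code_prod l' (code_w m)))) (iota 0 6) ->
  P_mx_prod l = P_mx_prod l'.
Proof.
move=> l0 l'0 cmp; apply: mx_uwP => m; have /allP/(_ (m : nat)) := cmp;
  rewrite mem_iota ltn_ord => /(_ isT) /andP[/eqP um /eqP wm].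
  have -> : u_ m = vec (code_u m) by rewrite vec_u ?inord_val.
  by rewrite !P_mx_prodE //; exact: eq_vec um.
have -> : w_ m = vec (code_w m) by rewrite vec_w ?inord_val.
by rewrite !P_mx_prodE //; exact: eq_vec wm.
Qed.

(** The semidirect product applies its rightmost permutation first, whence the reversal. *)
Lemma perm_P_prod l (m : 'I_6) : all distinct_indices l ->
  (P_prod l).2 m = foldl (fun m t => swap_nat t.1.2 t.2 m) (m : nat) (rev l) :> nat.
Proof.
rewrite foldl_rev; elim: l m => [|[[i j] k] l IHl] m; first by rewrite /= perm1.
move=> /andP[/and5P[i6 j6 k6 _ _] l0] /=.
by rewrite permM mul1g mulg1 nat_of_tperm // IHl.
Qed.

Lemma eq_P_prod l l' : all distinct_indices l -> all distinct_indices l' ->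
  expL_prod (tetra_exps l) = expL_prod (tetra_exps l') ->
  P_mx_prod l = P_mx_prod l' ->
  all (fun m => foldl (fun m t => swap_nat t.1.2 t.2 m) m (rev l) ==
                foldl (fun m t => swap_nat t.1.2 t.2 m) m (rev l')) (iota 0 6) ->
  P_prod l = P_prod l'.
Proof.
move=> l0 l'0 xl Ml cmp; apply: toJ_inj; first by rewrite !toJ_P_prod // xl Ml.
apply/permP => m; apply: val_inj => /=; rewrite !perm_P_prod //.
by apply/eqP; have /allP/(_ (m : nat)) := cmp; rewrite mem_iota ltn_ord; apply.
Qed.

Lemma P_prod_tetra : P_prod tetra_lhs = P_prod tetra_rhs.
Proof.
apply: eq_P_prod expL_prod_tetra _ _; [by []|by []| |by vm_compute].
by apply: eq_P_mx_prod; [by []|by []|vm_compute].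
Qed.

End Products.

(** The hypotheses of [psis_R_word], in computable form. *)
Definition good_triple (x : code * code * code) : bool :=
  let: (A, B, D) := x in
  [&& 0 < code_omega grading A, 0 < code_omega grading B,
      0 < code_omega grading D,
      code_omega A B == 1 & code_omega D B == 1].

Lemma tetra_codes_good :
  all good_triple (tetra_codes tetra_lhs ++ tetra_codes tetra_rhs).
Proof. by vm_compute. Qed.

(** * The two sides as words and their comparison *)

Section Tetrahedron.
Variables (K : numFieldType) (e : expmap K) (hbar : K) (lambda : 'I_6 -> K).
Hypothesis q_generic : not_root_of_unity (e hbar).
Local Notation z := (vec grading).
Local Notation psis := (@psis K e hbar 6 z).
Local Notation mono := (mono e lambda).
Local Notation ind := (nat * nat * nat)%type.
Local Notation qop := (qop e hbar 6).
Local Notation o i := (inord i : 'I_6).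

Definition word_of_triple
    (F : qmono K 6 -> qmono K 6 -> qmono K 6 -> seq (factor K 6)) (x : code * code * code) :=
  let: (A, B, D) := x in F (mono A) (mono B) (mono D).

(** Serves both forms of R, with F either [R_word] or [R_word']; the adjoint action on a word only
    transforms its three monomials. *)
Lemma prod_wordsE F (op : ind -> qop) l :
  (forall (g : jacobiS 6 e hbar) A B D,
     [seq (f.1, Ad g f.2) | f <- F A B D] = F (Ad g A) (Ad g B) (Ad g D)) ->
  (forall i j k, distinct_indices (i, j, k) -> op (i, j, k) =
     (F (R_A e (o i) (o k)) (R_B e (lambda (o k)) (o j) (o k))
        (R_D e (lambda (o i)) (lambda (o k)) (o i) (o j) (o k)),
      P_of e hbar lambda (i, j, k))) ->
  all distinct_indices l ->
  foldr (fun t x => op t ** x) ([::], 1%g) l =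
  (flatten [seq word_of_triple F x | x <- tetra_codes l], P_prod e hbar lambda l).
Proof.
move=> AdF opE; elim: l => [|[[i j] k] l IHl] //= /andP[t0 l0].
rewrite IHl // opE //; have /and5P[i6 j6 k6 ij /andP[jk ik]] := t0.
rewrite /qop_mul /=; congr (_ ++ _, _).
  rewrite /mono /code_A /code_B /code_D !parE !vecE !par_w !par_u !par_lam //.
  by rewrite !vec_w // !vec_u // !vec_lam // !subrr !addr0 !add0r !addrA.
rewrite map_flatten -!map_comp; congr flatten; apply: eq_map => -[[A B] D] /=.
by rewrite AdF !Ad_P_code // inord_neq.
Qed.

Lemma pos_factor_mono (b : bool) (s : code) :
  pos_factor z (b, mono s) = (0 < code_omega grading s).
Proof. exact: (pos_factor_letter e lambda (b, s)). Qed.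

Lemma flatten_map_cons (S T : Type) (g : S -> seq T) x xs :
  flatten (map g (x :: xs)) = g x ++ flatten (map g xs).
Proof. by []. Qed.

(** The chain of pentagons is given for the second form of R; this transfers its conclusion to the
    first. *)
Lemma psis_R_words xs f : all good_triple xs ->
  psis (flatten [seq word_of_triple (@R_word K 6) x | x <- xs]) f =
  psis (flatten [seq word_of_triple (@R_word' K 6) x | x <- xs]) f.
Proof.
elim: xs => // -[[A B] D] xs IHxs /andP[/and5P[A0 B0 D0 /eqP AB /eqP DB] xs0].
rewrite !flatten_map_cons !psis_cat (IHxs xs0).
by apply: psis_R_word; rewrite ?pos_factor_mono ?omega_code.
Qed.

Lemma pos_factor_R_words xs : all good_triple xs ->
  all (pos_factor z) (flatten [seq word_of_triple (@R_word K 6) x | x <- xs]).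
Proof.
elim: xs => // -[[A B] D] xs IHxs /andP[/and5P[A0 B0 D0 _ _] xs0].
rewrite flatten_map_cons all_cat IHxs //= !pos_factor_sym ?pos_factor_mono //.
by rewrite A0 D0.
Qed.

Lemma flatten_R_word' l :
  flatten [seq word_of_triple (@R_word' K 6) x | x <- tetra_codes l] =
  map (factor_of e lambda) (tetra_word l).
Proof.
rewrite /tetra_word map_flatten -map_comp; congr flatten.
by apply: eq_map => -[[A B] D].
Qed.

Definition R_of (t : ind) : qop := let: (i, j, k) := t in
  R_op e hbar (lambda (o i)) (lambda (o j)) (lambda (o k)) (o i) (o j) (o k).

Definition R_of' (t : ind) : qop := let: (i, j, k) := t in
  R_op' e hbar (lambda (o i)) (lambda (o j)) (lambda (o k)) (o i) (o j) (o k).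

Definition R_prod (l : seq ind) : qop :=
  foldr (fun t x => R_of t ** x) ([::], 1%g) l.

Definition R_prod' (l : seq ind) : qop :=
  foldr (fun t x => R_of' t ** x) ([::], 1%g) l.

Lemma R_prodE l : all distinct_indices l -> R_prod l =
  (flatten [seq word_of_triple (@R_word K 6) x | x <- tetra_codes l],
   P_prod e hbar lambda l).
Proof.
apply: prod_wordsE => [g A B D|i j k _]; last exact: R_opE.
by rewrite /R_word /= !Ad_sym.
Qed.

Lemma R_prod'E l : all distinct_indices l -> R_prod' l =
  (map (factor_of e lambda) (tetra_word l), P_prod e hbar lambda l).
Proof.
rewrite -flatten_R_word'; apply: prod_wordsE => // i j k.
by case/and5P => i6 j6 k6 ij /andP[jk ik]; apply: R_op'E; rewrite inord_neq.
Qed.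

Lemma R_prod_eq l ms l' : all distinct_indices l -> all distinct_indices l' ->
  derives (tetra_word l) ms (tetra_word l') ->
  all pos_letter (tetra_word l ++ tetra_word l') ->
  all good_triple (tetra_codes l ++ tetra_codes l') ->
  P_prod e hbar lambda l = P_prod e hbar lambda l' ->
  R_prod l === R_prod l' /\ R_prod' l === R_prod' l'.
Proof.
move=> l0 l'0 ll' + + Pll'; rewrite !all_cat => /andP[w0 w'0] /andP[g0 g'0].
rewrite !R_prodE // !R_prod'E //; split; apply: (qop_eq_psis (z := z)) => //=.
- exact: pos_factor_R_words.
- exact: pos_factor_R_words.
- by move=> f; rewrite !psis_R_words // !flatten_R_word' (derives_sound _ _ _ ll').
- by rewrite pos_factor_letters.
- by rewrite pos_factor_letters.
- by move=> f; rewrite (derives_sound _ _ _ ll').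
Qed.

(** Passes from the products nested to the right, suited to induction, to those nested to the
    left. *)
Lemma R_prod4 t1 t2 t3 t4 :
  R_prod [:: t1; t2; t3; t4] = R_of t1 ** R_of t2 ** R_of t3 ** R_of t4.
Proof. by rewrite /R_prod /foldr qop_mul1 !qop_mulA. Qed.

Lemma R_prod'4 t1 t2 t3 t4 :
  R_prod' [:: t1; t2; t3; t4] = R_of' t1 ** R_of' t2 ** R_of' t3 ** R_of' t4.
Proof. by rewrite /R_prod' /foldr qop_mul1 !qop_mulA. Qed.

Lemma R_prod4_eq t1 t2 t3 t4 (l := [:: t1; t2; t3; t4])
    (l' := [:: t4; t3; t2; t1]) :
  R_prod l === R_prod l' /\ R_prod' l === R_prod' l' ->
  R_of t1 ** R_of t2 ** R_of t3 ** R_of t4 ===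
  R_of t4 ** R_of t3 ** R_of t2 ** R_of t1 /\
  R_of' t1 ** R_of' t2 ** R_of' t3 ** R_of' t4 ===
  R_of' t4 ** R_of' t3 ** R_of' t2 ** R_of' t1.
Proof.
rewrite -(R_prod4 t1) -(R_prod4 t4) -(R_prod'4 t1) -(R_prod'4 t4).
exact: id.
Qed.

End Tetrahedron.

Theorem theorem4p3 (R : realType) (hbar : R[i])
    (q_generic : not_root_of_unity (cexp R hbar)) (lambda : 'I_6 -> R[i]) :
  let R_ i j k := R_op (cexp R) hbar (lambda i) (lambda j) (lambda k) i j k in
  let R'_ i j k := R_op' (cexp R) hbar (lambda i) (lambda j) (lambda k) i j k in
  let i1 : 'I_6 := inord 0 in let i2 : 'I_6 := inord 1 in
  let i3 : 'I_6 := inord 2 in let i4 : 'I_6 := inord 3 in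
  let i5 : 'I_6 := inord 4 in let i6 : 'I_6 := inord 5 in
  [/\ forall i j k : 'I_6, i != j -> j != k -> i != k -> R_ i j k === R'_ i j k,
      R_ i4 i5 i6 ** R_ i2 i3 i6 ** R_ i1 i3 i5 ** R_ i1 i2 i4
      === R_ i1 i2 i4 ** R_ i1 i3 i5 ** R_ i2 i3 i6 ** R_ i4 i5 i6
    & R'_ i4 i5 i6 ** R'_ i2 i3 i6 ** R'_ i1 i3 i5 ** R'_ i1 i2 i4
      === R'_ i1 i2 i4 ** R'_ i1 i3 i5 ** R'_ i2 i3 i6 ** R'_ i4 i5 i6].
Proof.
move=> R_ R'_ i1 i2 i3 i4 i5 i6.
have [tR tR'] := R_prod4_eq (@R_prod_eq _ _ hbar lambda q_generic
  tetra_lhs tetra_moves tetra_rhs isT isT tetra_derives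
  tetra_word_pos tetra_codes_good (P_prod_tetra _ hbar lambda)).
split=> [i j k ij jk ik||]; first exact: R_op_R_op'.
- exact: tR.
- exact: tR'.
Qed.
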